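(* Let $F: L\times U\times[0,T)\to\mathbb{C}\cong\mathbb{R}^2$ be a foliation moved under mean curvature flow (as defined in the context), let $W=\{(y,t): t\in[0,T),\ y\in W_t\}\subset\mathbb{R}^2\times[0,T)$, and let $\theta: W\to\mathbb{R}/2\pi\mathbb{Z}$ be the corresponding Lagrangian angle function of the foliation. Then $\theta$ satisfies on $W$ the equation $$\frac{\partial\theta}{\partial t}=\theta_{11}\cos^2\theta+2\theta_{12}\sin\theta\cos\theta+\theta_{22}\sin^2\theta,$$ where $\theta_{ij}=\frac{\partial^2\theta}{\partial y^i\partial y^j}$ are the second partial derivatives with respect to the standard coordinates $y^1,y^2$ of $\mathbb{R}^2$, and $\frac{\partial\theta}{\partial t}$ is the partial derivative with respect to the $t$ variable of $W$ (with $y$ held fixed).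
   Context: Here $\mathbb{C}\cong\mathbb{R}^2$ carries the standard Euclidean metric and coordinates $(y^1,y^2)$. A foliation moved under mean curvature flow is a $C^\infty$ map $F: L\times U\times[0,T)\to\mathbb{C}$, where $L$ is an oriented $1$-dimensional manifold and $U\subset\mathbb{R}$ is open, such that: (1) for each fixed $u\in U$ and $t\in[0,T)$, $F(\cdot,u,t): L\to\mathbb{C}$ is an embedding (of a curve; in complex dimension one every such curve is Lagrangian); (2) for each fixed $t$, the map $F_t:=F(\cdot,\cdot,t): L\times U\to\mathbb{C}$ is a diffeomorphism onto an open set $W_t\subset\mathbb{C}$; (3) for each fixed $u\in U$, $F(\cdot,u,\cdot)$ solves the mean curvature flow, i.e. $\frac{\partial}{\partial t}F(x,u,t)=H(x,u,t)$, where $H(x,u,t)$ is the mean curvature vector (the trace of the second fundamental form) of the curve $F(\cdot,u,t)$ at $x$. The Lagrangian angle of an oriented curve in $\mathbb{C}$ is the function with values in $\mathbb{R}/2\pi\mathbb{Z}$ defined by $dz|_{T_xL}=e^{i\theta(x)}\,d\mathrm{vol}_L$; equivalently, the positively oriented unit tangent vector at $x$ is $(\cos\theta(x),\sin\theta(x))$. For a foliation $F: L\times U\times[0,T)\to\mathbb{C}$ moved under mean curvature flow, let $\theta_F(x,u,t)$ be the Lagrangian angle at $x$ of the curve $F(\cdot,u,t)$. This is a smooth function $L\times U\times[0,T)\to\mathbb{R}/2\pi\mathbb{Z}$. The Lagrangian angle function of the foliation is $\theta: W\to\mathbb{R}/2\pi\mathbb{Z}$, $\theta(y,t):=\theta_F(F_t^{-1}(y),t)$.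 Derivatives of an $\mathbb{R}/2\pi\mathbb{Z}$-valued function are those of any local real-valued lift. *)

(* Defs.v *)
From HB Require Import structures.
From mathcomp Require Import all_boot all_order all_algebra ring_quotient.
From mathcomp Require Import all_classical all_reals all_analysis.

Set Implicit Arguments.
Unset Strict Implicit.
Unset Printing Implicit Defensive.

Import Order.TTheory GRing.Theory Num.Theory.
Import numFieldNormedType.Exports.

Local Open Scope classical_set_scope.
Local Open Scope ring_scope.

(* [f] is C^k on the open set [O]. *)
Fixpoint Ck (R : realType) (V W : normedModType R) (k : nat) (O : set V)
    (f : V -> W) : Prop :=
  match k with
  | 0%N => forall x, O x -> {for x, continuous f}
  | k'.+1 => (forall x, O x -> differentiable f x) /\
             (forall v, Ck k' O ('D_v f))
  end.

(* C^oo on an arbitrary subset [S]: locally the restriction of a C^oo map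
   defined on an open set. For open [S] this is ordinary smoothness; it is also
   what gives a meaning to smoothness up to [t = 0] on [0, T). *)
Definition smooth_on (R : realType) (V W : normedModType R) (S : set V)
    (f : V -> W) : Prop :=
  forall p, S p -> exists O : set V, exists g : V -> W,
    [/\ open O, O p, forall k, Ck k O g & {in S `&` O, f =1 g}].

(* [f] has derivative [d] at [t] relative to [I]; this is the one-sided
   derivative when [t] is an endpoint of the interval [I]. *)
Definition is_derive_within (R : realType) (W : normedModType R) (I : set R)
    (f : R -> W) (t : R) (d : W) : Prop :=
  (s - t)^-1 *: (f s - f t) @[s --> within I t^'] --> d.

(* [chart_inv] is only meaningful on [chart_cod]. *)
Record chart (R : realType) (L : topologicalType) := Chart {
  chart_dom : set L;
  chart_map : L -> R;
  chart_inv : R -> L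
}.

Definition chart_cod (R : realType) (L : topologicalType) (c : chart R L) :
  set R := chart_map c @` chart_dom c.

Record is_chart (R : realType) (L : topologicalType) (c : chart R L) : Prop := {
  chart_dom_open : open (chart_dom c);
  chart_cod_open : open (chart_cod c);
  chart_mapK : {in chart_dom c, cancel (chart_map c) (chart_inv c)};
  chart_map_continuous : {within chart_dom c, continuous (chart_map c)};
  chart_inv_continuous : {within chart_cod c, continuous (chart_inv c)}
}.

Record oriented_atlas (R : realType) (L : topologicalType)
    (A : set (chart R L)) : Prop := {
  atlas_chart : forall c, A c -> is_chart c;
  atlas_cover : forall x, exists2 c, A c & chart_dom c x;
  atlas_smooth : forall c c', A c -> A c' ->
    smooth_on (chart_map c @` (chart_dom c `&` chart_dom c'))
              (chart_map c' \o chart_inv c : R -> R);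
  atlas_oriented : forall c c', A c -> A c' ->
    forall x, chart_dom c x -> chart_dom c' x ->
      0 < derive1 (chart_map c' \o chart_inv c : R -> R) (chart_map c x)
}.

Record oriented_1manifold (R : realType) (L : topologicalType)
    (A : set (chart R L)) : Prop := {
  manifold_hausdorff : hausdorff_space L;
  manifold_countable : @second_countable L;
  manifold_atlas : oriented_atlas A
}.

Definition smooth_from_manifold (R : realType) (L : topologicalType)
    (A : set (chart R L)) (W : normedModType R) (f : L -> W) : Prop :=
  forall c, A c -> smooth_on (chart_cod c) (f \o chart_inv c).

(* smoothness of [f] on the product of the manifold with a subset [S] of a
   normed space *)
Definition smooth_from_prod (R : realType) (L : topologicalType)
    (A : set (chart R L)) (V W : normedModType R) (S : set V)
    (f : L -> V -> W) : Prop :=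
  forall c, A c ->
    smooth_on (chart_cod c `*` S) (fun p : R * V => f (chart_inv c p.1) p.2).

(* smoothness of a map from the subset [S] of a normed space to the manifold *)
Definition smooth_to_manifold (R : realType) (L : topologicalType)
    (A : set (chart R L)) (V : normedModType R) (S : set V) (g : V -> L) :
    Prop :=
  {within S, continuous g} /\
  forall c, A c ->
    smooth_on (S `&` g @^-1` chart_dom c) (chart_map c \o g : V -> R).

(* injective immersion which is a homeomorphism onto its image *)
Record smooth_embedding (R : realType) (L : topologicalType)
    (A : set (chart R L)) (W : normedModType R) (f : L -> W) : Prop := {
  embedding_smooth : smooth_from_manifold A f;
  embedding_immersion : forall c s, A c -> chart_cod c s ->
    derive1 (f \o chart_inv c : R -> W) s != 0;
  embedding_inj : injective f;
  embedding_open : forall O : set L, open O ->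
    exists2 O' : set W, open O' & f @` O = O' `&` range f
}.

(* C = R^2, with its real coordinates; the library's norm on the product type is
   the max norm, hence the explicit Euclidean structure. *)
Notation plane R := (R * R)%type.

Definition dot (R : realType) (v w : plane R) : R := v.1 * w.1 + v.2 * w.2.
Definition enorm (R : realType) (v : plane R) : R := Num.sqrt (dot v v).

(* A(d/ds, d/ds): the component of the ambient derivative of d/ds which is
   normal to the curve *)
Definition second_fundamental_form (R : realType) (gamma : R -> plane R)
    (s : R) : plane R :=
  let v := derive1 gamma s in
  let a := derive1 (derive1 gamma) s in
  a - (dot a v / dot v v) *: v.

(* the trace g^{ss} A(d/ds, d/ds) with respect to the induced metric
   g_{ss} = |gamma'|^2 *)
Definition mean_curvature (R : realType) (gamma : R -> plane R) (s : R) :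
    plane R :=
  (dot (derive1 gamma s) (derive1 gamma s))^-1 *: second_fundamental_form gamma s.

Definition two_pi_int (R : realType) : {pred R} :=
  fun x => `[< exists k : int, x = k%:~R * (2 * pi) >].

Lemma two_pi_int_zmod_closed (R : realType) : zmod_closed (@two_pi_int R).
Proof.
split; first by apply/asboolP; exists 0; rewrite mul0r.
move=> x y /asboolP[k ->] /asboolP[l ->]; apply/asboolP; exists (k - l).
by rewrite intrB mulrBl.
Qed.

HB.instance Definition _ (R : realType) :=
  GRing.isZmodClosed.Build R (@two_pi_int R) (@two_pi_int_zmod_closed R).

Definition angle (R : realType) := Quotient.quot (@two_pi_int R).

Definition to_angle (R : realType) (a : R) : angle R :=
  (\pi_(angle R) a)%qT.

(* [a] is the Lagrangian angle at [s] of the curve parametrised positively by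
   [gamma]: evaluated on d/ds, [dz = e^{i a} dvol] reads
   [gamma' = |gamma'| (cos a, sin a)]. *)
Definition is_lagrangian_angle (R : realType) (gamma : R -> plane R) (s : R)
    (a : angle R) : Prop :=
  exists2 r : R, to_angle r = a &
    derive1 gamma s = enorm (derive1 gamma s) *: (cos r, sin r).

(* [0, T), where [T] may be infinite *)
Definition time_interval (R : realType) (T : \bar R) : set R :=
  [set t | 0 <= t /\ (t%:E < T)%E].

(* the curve F(., u, t) read in the chart [c] *)
Definition leaf (R : realType) (L : topologicalType)
    (F : L -> R -> R -> plane R) (c : chart R L) (u t : R) : R -> plane R :=
  fun s => F (chart_inv c s) u t.

Definition slice (R : realType) (L : topologicalType) (U : set R)
    (F : L -> R -> R -> plane R) (t : R) : set (plane R) :=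
  [set y | exists x, exists2 u, U u & F x u t = y].

Definition spacetime (R : realType) (L : topologicalType) (U : set R)
    (T : \bar R) (F : L -> R -> R -> plane R) : set (plane R * R) :=
  [set p | time_interval T p.2 /\ slice U F p.2 p.1].

(* F_t is a diffeomorphism from L x U onto the open set W_t *)
Record slice_diffeomorphism (R : realType) (L : topologicalType)
    (A : set (chart R L)) (U : set R) (F : L -> R -> R -> plane R) (t : R) :
    Prop := {
  slice_open : open (slice U F t);
  slice_smooth : smooth_from_prod A U (fun x u => F x u t);
  slice_inverse : exists gL : plane R -> L, exists gU : plane R -> R,
    [/\ forall x u, U u -> gL (F x u t) = x /\ gU (F x u t) = u,
        smooth_to_manifold A (slice U F t) gL &
        smooth_on (slice U F t) gU]
}.

(* [F] is total, but only its values on L x U x [0, T) matter. *)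
Record mcf_foliation (R : realType) (L : topologicalType)
    (A : set (chart R L)) (U : set R) (T : \bar R)
    (F : L -> R -> R -> plane R) : Prop := {
  foliation_smooth :
    smooth_from_prod A (U `*` time_interval T)
      (fun x (q : R * R) => F x q.1 q.2);
  foliation_embedding : forall u t, U u -> time_interval T t ->
    smooth_embedding A (fun x => F x u t);
  foliation_diffeomorphism : forall t, time_interval T t ->
    slice_diffeomorphism A U F t;
  foliation_mcf : forall c x u t,
    A c -> chart_dom c x -> U u -> time_interval T t ->
    is_derive_within (time_interval T) (F x u) t
      (mean_curvature (leaf F c u t) (chart_map c x))
}.

Definition leaf_angle (R : realType) (L : topologicalType)
    (A : set (chart R L)) (U : set R) (T : \bar R)
    (F : L -> R -> R -> plane R) (thetaF : L -> R -> R -> angle R) : Prop :=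
  forall c x u t, A c -> chart_dom c x -> U u -> time_interval T t ->
    is_lagrangian_angle (leaf F c u t) (chart_map c x) (thetaF x u t).

(* theta (y, t) = thetaF (F_t^{-1} y, t) on W *)
Definition foliation_angle (R : realType) (L : topologicalType)
    (A : set (chart R L)) (U : set R) (T : \bar R)
    (F : L -> R -> R -> plane R) (theta : plane R * R -> angle R) : Prop :=
  exists2 thetaF, leaf_angle A U T F thetaF &
    forall x u t, U u -> time_interval T t ->
      theta (F x u t, t) = thetaF x u t.

(* [l] is, near [p], a continuous real-valued lift of [theta] on [W]; its values
   outside [W] are unconstrained. *)
Definition local_lift (R : realType) (W : set (plane R * R))
    (theta : plane R * R -> angle R) (p : plane R * R)
    (l : plane R * R -> R) : Prop :=
  exists O : set (plane R * R),
    [/\ open O, O p, {within W `&` O, continuous l} &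
        {in W `&` O, forall q, to_angle (l q) = theta q}].

Definition e1 (R : realType) : plane R := (1, 0).
Definition e2 (R : realType) : plane R := (0, 1).

Definition twice_derivable (R : realType) (f : plane R -> R) (y : plane R) :
    Prop :=
  forall v w : plane R, v \in [:: e1 R; e2 R] -> w \in [:: e1 R; e2 R] ->
    (\forall z \near y, derivable f z v) /\ derivable ('D_v f) y w.

(* the derivatives entering the equation exist at [p], and the equation holds *)
Definition angle_equation_at (R : realType) (T : \bar R)
    (l : plane R * R -> R) (p : plane R * R) : Prop :=
  let f : plane R -> R := fun z => l (z, p.2) in
  let th := l p in
  twice_derivable f p.1 /\
  is_derive_within (time_interval T) (fun s => l (p.1, s) : R) p.2
    ('D_(e1 R) ('D_(e1 R) f) p.1 * cos th ^+ 2
     + 2 * 'D_(e1 R) ('D_(e2 R) f) p.1 * sin th * cos th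
     + 'D_(e2 R) ('D_(e2 R) f) p.1 * sin th ^+ 2).

(* Main.v *)
From HB Require Import structures.
Require Import Defs.
From mathcomp Require Import all_boot all_order all_algebra ring_quotient.
From mathcomp Require Import all_classical all_reals all_analysis.
From mathcomp Require Import ring lra.
Import Order.TTheory GRing.Theory Num.Theory.
Import numFieldNormedType.Exports.
Set Implicit Arguments.
Unset Strict Implicit.
Unset Printing Implicit Defensive.
Local Open Scope classical_set_scope.
Local Open Scope ring_scope.

(** Let [F] be a foliation moved under mean curvature flow. Near a point
    [(y0, t0)], with [y0 = F (x0, u0, t0)], the parameters are read in a chart of
    the manifold, where [F] is a smooth map [G (s, u, t)].

    In the chart the angle is a function [alpha (s, u, t)], the angle of the
    velocity [v = dG/ds]. At time [t0] it is also a function [f] of the plane. Let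
    [T = v / |v|] be the unit tangent, [N] the unit normal and [H] the mean
    curvature vector. Differentiation of the angle along a leaf gives the curvature
    [Df (T)], so [H = Df (T) N]. Since [dG/dt = H] and mixed derivatives commute
    ([derive_comm]), [dv/dt] is the derivative of [H] along the leaf, and its normal
    component gives
      [d alpha/dt = D^2 f (T, T) + Df (H)],
    which is [angle_evolution]. The left-hand side is the derivative that follows
    the motion of a point of the leaf, which has velocity [H]. At a fixed point of
    the plane the transport term [Df (H)] disappears, and what remains is
      [d theta/dt = D^2 f (T, T)]
    with [T = (cos theta, sin theta)]. This is the equation.

    To pass from moving to fixed points, the inverse of [F_t] must exist near [y0]
    for all [t] close to [t0], with continuity in [t], and be differentiable in [t]
    at [t0]. The hypotheses give a smooth inverse at time [t0]; composed with it,
    [F_t] becomes a map [K (-, t)] of the plane with [K (y, t0) = y], hence a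
    perturbation of the identity by a map with a small Lipschitz constant. The fixed
    point theorem for contractions inverts it, and the inverse moves with velocity [- H]
    ([param_inverse]). This yields a lift of the angle near [(y0, t0)] that
    satisfies the equation ([lift_evolution]). Any other lift differs from it by a
    constant multiple of [2 pi] ([lift_unique]), which gives the statement for all
    lifts ([angle_equation_local]).

    The map [F] is only defined for [t >= 0], but it is smooth up to [t = 0], so [G]
    extends to negative times. The construction is carried out for the extension,
    and [theta] is compared with it at times in the interval only. *)

(** * Directional derivatives and functions of class C^k *)

Section Calculus.
Context {R : realType}.

Lemma continuous_fst (V W : topologicalType) : continuous (@fst V W).
Proof. by move=> [x y]; exact: cvg_fst. Qed.

Lemma continuous_snd (V W : topologicalType) : continuous (@snd V W).
Proof. by move=> [x y]; exact: cvg_snd. Qed.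

Lemma differentiable_is_derive (V W : normedModType R) (f : V -> W) x v :
  differentiable f x -> is_derive x v f ('D_v f x).
Proof. by move=> df; apply: DeriveDef => //; exact: diff_derivable. Qed.

Lemma is_derive_comp_curve (V W : normedModType R) (f : V -> W) (c : R -> V)
    (s : R) w :
  is_derive s 1 c w -> differentiable f (c s) ->
  is_derive s 1 (f \o c) ('D_w f (c s)).
Proof.
move=> [dc cw] df.
have dc' : differentiable c s by apply/derivable1_diffP.
have dfc : differentiable (f \o c) s by exact: differentiable_comp.
have -> : 'D_w f (c s) = 'D_1 (f \o c) s.
  have dcw : 'd c s 1 = w by rewrite -deriveE.
  by rewrite [RHS]deriveE// diff_comp//= dcw deriveE.
exact: differentiable_is_derive.
Qed.

Lemma is_derive_pair (V W X : normedModType R) (f : X -> V) (g : X -> W) x v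
    a b :
  is_derive x v f a -> is_derive x v g b ->
  is_derive x v (fun y => (f y, g y)) (a, b).
Proof.
move=> [/cvg_ex[a' fa] <-] [/cvg_ex[b' gb] <-].
have fga : h^-1 *: ((fun y => (f y, g y)) (h *: v + x) - (f x, g x))
   @[h --> 0^'] --> (a', b') by exact: (cvg_pair fa gb).
rewrite /derive (cvg_lim _ fa)// (cvg_lim _ gb)//.
by apply: DeriveDef; [apply/cvg_ex; exists (a', b')|exact: cvg_lim fga].
Qed.

Lemma is_derive_fst (V W X : normedModType R) (f : X -> V * W) x v d :
  is_derive x v f d -> is_derive x v (fun y => (f y).1) d.1.
Proof.
move=> [/cvg_ex[a fa] <-].
have fa1 : h^-1 *: ((f (h *: v + x)).1 - (f x).1) @[h --> 0^'] --> a.1.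
  exact: (cvg_comp _ _ fa (@continuous_fst _ _ _)).
rewrite /derive (cvg_lim _ fa)//.
by apply: DeriveDef; [apply/cvg_ex; exists a.1|exact: cvg_lim fa1].
Qed.

Lemma is_derive_snd (V W X : normedModType R) (f : X -> V * W) x v d :
  is_derive x v f d -> is_derive x v (fun y => (f y).2) d.2.
Proof.
move=> [/cvg_ex[a fa] <-].
have fa1 : h^-1 *: ((f (h *: v + x)).2 - (f x).2) @[h --> 0^'] --> a.2.
  exact: (cvg_comp _ _ fa (@continuous_snd _ _ _)).
rewrite /derive (cvg_lim _ fa)//.
by apply: DeriveDef; [apply/cvg_ex; exists a.2|exact: cvg_lim fa1].
Qed.

Lemma differentiable_fst (V W X : normedModType R) (f : X -> V * W) x :
  differentiable f x -> differentiable (fun y => (f y).1) x.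
Proof.
move=> df; apply: (@differentiable_comp _ _ _ _ f fst) => //.
by apply: linear_differentiable; exact: continuous_fst.
Qed.

Lemma differentiable_snd (V W X : normedModType R) (f : X -> V * W) x :
  differentiable f x -> differentiable (fun y => (f y).2) x.
Proof.
move=> df; apply: (@differentiable_comp _ _ _ _ f snd) => //.
by apply: linear_differentiable; exact: continuous_snd.
Qed.

Lemma derive_dirD (V W : normedModType R) (f : V -> W) x v w :
  differentiable f x -> 'D_(v + w) f x = 'D_v f x + 'D_w f x.
Proof. by move=> df; rewrite !deriveE// linearD. Qed.

Lemma derive_dirZ (V W : normedModType R) (f : V -> W) x k v :
  differentiable f x -> 'D_(k *: v) f x = k *: 'D_v f x.
Proof. by move=> df; rewrite !deriveE// linearZ. Qed.

(** The differential of [f] is also a first-order approximation of [g], and such an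
    approximation is unique. *)
Lemma near_eq_differentiable (V W : normedModType R) (f g : V -> W) x :
  {near x, f =1 g} -> differentiable f x -> differentiable g x.
Proof.
move=> fg df.
have [dc /eqaddoP fE] := (diff_locallyP x f).1 df.
have gE : g \o shift x = cst (g x) + 'd f x +o_ 0 id.
  apply/eqaddoP => e e0; have := fE e e0.
  move: (fg); rewrite (near_shift 0 x) subr0; apply: filterS2 => h /= fgh.
  move: (nbhs_singleton fg) fgh; rewrite /= !fctE /= => fgx fgh.
  by rewrite fgx fgh.
by apply/diff_locallyP; rewrite (diff_unique dc gE).
Qed.

Lemma differentiable_atan (V : normedModType R) (f : V -> R) x :
  differentiable f x -> differentiable (fun y => atan (f y)) x.
Proof.
move=> df; apply: (@differentiable_comp _ _ _ _ f (@atan R)) => //.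
by apply/derivable1_diffP; exact: derivable_atan.
Qed.

Lemma derive_atan (V : normedModType R) (f : V -> R) x v :
  differentiable f x ->
  'D_v (fun y => atan (f y)) x = (1 + f x ^+ 2)^-1 * 'D_v f x.
Proof.
move=> df; have datan : differentiable (@atan R) (f x).
  by apply/derivable1_diffP; exact: derivable_atan.
rewrite deriveE; last exact: differentiable_atan.
rewrite (@diff_comp _ _ _ _ f (@atan R))//=.
have datanE w : 'd (@atan R) (f x) w = (1 + f x ^+ 2)^-1 * w.
  rewrite -deriveE// -[w in LHS]mulr1 [LHS]derive_dirZ//.
  by rewrite -derive1E derive1_atan mulrC.
by rewrite [LHS]datanE -deriveE.
Qed.

Section Ck.
Variable V : normedModType R.
Implicit Types (O : set V).

(** The class C^k is defined by induction through directional derivatives, which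
    are functions on the whole space; only their values on the open set matter,
    and this is what lets the usual rules of differentiation, valid on that set
    alone, be used in the inductions below. *)
Lemma Ck_eq (W : normedModType R) k O (f g : V -> W) : open O ->
  {in O, f =1 g} -> Ck k O f -> Ck k O g.
Proof.
move=> oO; elim: k f g => [|k IH] f g fg /=.
  move=> fO x Ox; rewrite /prop_for /continuous_at -(fg x) ?inE//.
  apply: cvg_trans (fO x Ox); apply: near_eq_cvg.
  by apply: filterS (open_nbhs_nbhs (conj oO Ox)) => y Oy; rewrite fg ?inE.
have fgx x : O x -> {near x, f =1 g}.
  move=> Ox; apply: filterS (open_nbhs_nbhs (conj oO Ox)) => y Oy.
  by rewrite fg ?inE.
move=> [df Df]; split=> [x Ox|v]; last first.
  apply: IH (Df v) => x /set_mem Ox; exact/near_eq_derive/fgx.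
exact: near_eq_differentiable (fgx x Ox) (df x Ox).
Qed.

Lemma Ck_subset (W : normedModType R) k O O' (f : V -> W) : O' `<=` O ->
  Ck k O f -> Ck k O' f.
Proof.
move=> O'O; elim: k f => [|k IH] f /=; first by move=> fc x /O'O/fc.
by move=> [df Df]; split=> [x /O'O/df//|v]; exact: IH.
Qed.

Lemma CkS (W : normedModType R) k O (f : V -> W) : Ck k.+1 O f -> Ck k O f.
Proof.
elim: k f => [|k IH] f; first by move=> [df _] x /df/differentiable_continuous.
by move=> [df Df]; split=> // v; exact: IH.
Qed.

Lemma Ck_differentiable (W : normedModType R) k O (f : V -> W) x :
  Ck k.+1 O f -> O x -> differentiable f x.
Proof. by move=> [df _] /df. Qed.

Lemma Ck_cst (W : normedModType R) k O (a : W) : Ck k O (fun=> a : W).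
Proof.
elim: k a => [|k IH] a /=; first by move=> x _; exact: cst_continuous.
split=> [x _|v]; first exact: differentiable_cst.
have -> : 'D_v (fun=> a : W) = (fun=> 0 : W) by apply/funext => x; exact: derive_cst.
exact: IH.
Qed.

Lemma Ck_linear (W : normedModType R) k O (f : {linear V -> W}) :
  continuous f -> Ck k O f.
Proof.
move=> fc; have df x : differentiable f x by exact: linear_differentiable.
case: k => [|k] /=; first by move=> x _; exact: fc.
split=> // v; have -> : 'D_v f = (fun=> f v).
  by apply/funext => x; rewrite deriveE// diff_lin.
exact: Ck_cst.
Qed.

Lemma Ck_add (W : normedModType R) k O (f g : V -> W) : open O ->
  Ck k O f -> Ck k O g -> Ck k O (fun x => f x + g x).
Proof.
move=> oO; elim: k f g => [|k IH] f g /=.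
  by move=> fc gc x Ox; apply: continuousD; [exact: fc|exact: gc].
move=> [df Df] [dg Dg]; split=> [x Ox|v].
  by apply: differentiableD; [exact: df|exact: dg].
apply: (Ck_eq oO _ (IH _ _ (Df v) (Dg v))) => x /set_mem Ox.
by rewrite deriveD//; apply: diff_derivable; [exact: df|exact: dg].
Qed.

Lemma Ck_opp (W : normedModType R) k O (f : V -> W) : open O ->
  Ck k O f -> Ck k O (fun x => - f x).
Proof.
move=> oO; elim: k f => [|k IH] f /=.
  by move=> fc x Ox; apply: continuousN; exact: fc.
move=> [df Df]; split=> [x Ox|v]; first by apply: differentiableN; exact: df.
apply: (Ck_eq oO _ (IH _ (Df v))) => x /set_mem Ox.
by rewrite deriveN//; apply: diff_derivable; exact: df.
Qed.

Lemma Ck_subr (W : normedModType R) k O (f g : V -> W) : open O ->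
  Ck k O f -> Ck k O g -> Ck k O (fun x => f x - g x).
Proof. by move=> oO fC gC; apply: Ck_add => //; exact: Ck_opp. Qed.

Lemma Ck_fst (W X : normedModType R) k O (f : V -> W * X) : open O ->
  Ck k O f -> Ck k O (fun x => (f x).1).
Proof.
move=> oO; elim: k f => [|k IH] f /=.
  move=> fc x /fc fcx; exact: (cvg_comp _ _ fcx (@continuous_fst _ _ _)).
move=> [df Df]; split=> [x /df dfx|v]; first exact: differentiable_fst.
apply: (Ck_eq oO _ (IH _ (Df v))) => x /set_mem/df dfx; apply/esym.
by have [_ /= ->] := is_derive_fst (differentiable_is_derive v dfx).
Qed.

Lemma Ck_snd (W X : normedModType R) k O (f : V -> W * X) : open O ->
  Ck k O f -> Ck k O (fun x => (f x).2).
Proof.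
move=> oO; elim: k f => [|k IH] f /=.
  move=> fc x /fc fcx; exact: (cvg_comp _ _ fcx (@continuous_snd _ _ _)).
move=> [df Df]; split=> [x /df dfx|v]; first exact: differentiable_snd.
apply: (Ck_eq oO _ (IH _ (Df v))) => x /set_mem/df dfx; apply/esym.
by have [_ /= ->] := is_derive_snd (differentiable_is_derive v dfx).
Qed.

Lemma Ck_mul k O (f g : V -> R) : open O ->
  Ck k O f -> Ck k O g -> Ck k O (fun x => f x * g x).
Proof.
move=> oO; elim: k f g => [|k IH] f g.
  by move=> fc gc x Ox; apply: continuousM; [exact: fc|exact: gc].
move=> fC gC; have [df Df] := fC; have [dg Dg] := gC; split=> [x Ox|v].
  by apply: differentiableM; [exact: df|exact: dg].
have := Ck_add oO (IH _ _ (CkS fC) (Dg v)) (IH _ _ (CkS gC) (Df v)).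
apply: Ck_eq => // x /set_mem Ox.
by rewrite deriveM//; apply: diff_derivable; [exact: df|exact: dg].
Qed.

(** Since [D(1/f) = - (1/f) (1/f) Df], the induction hypothesis is used for [1/f]
    itself; this is why a class of lower order has to be available through
    [CkS]. *)
Lemma Ck_inv k O (f : V -> R) : open O -> (forall x, O x -> f x != 0) ->
  Ck k O f -> Ck k O (fun x => (f x)^-1).
Proof.
move=> oO f0; elim: k f f0 => [|k IH] f f0.
  by move=> fc x Ox; apply: cvgV; [exact: f0|exact: fc].
move=> fC; have [df Df] := fC; split=> [x Ox|v].
  by apply: differentiableV; [exact: df|exact: f0].
have fI := IH _ f0 (CkS fC).
have := Ck_opp oO (Ck_mul oO (Ck_mul oO fI fI) (Df v)).
apply: Ck_eq => // x /set_mem Ox.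
rewrite deriveV//; [|exact: f0|by apply: diff_derivable; exact: df].
by rewrite -[LHS]mulNr -invfM -expr2.
Qed.

Lemma Ck_atan k O (f : V -> R) : open O ->
  Ck k O f -> Ck k O (fun x => atan (f x)).
Proof.
move=> oO fC; case: k fC => [|k] fC.
  by move=> x Ox; apply: continuous_comp; [exact: fC|exact: continuous_atan].
have [df Df] := fC; split=> [x Ox|v]; first by apply: differentiable_atan; exact: df.
have fC' := CkS fC.
have d0 x : O x -> 1 + f x * f x != 0.
  by move=> _; rewrite gt_eqF// ltr_pwDl// -expr2 sqr_ge0.
have := Ck_mul oO (Ck_inv oO d0 (Ck_add oO (Ck_cst k O (1 : R)) (Ck_mul oO fC' fC')))
  (Df v).
apply: Ck_eq => // x /set_mem Ox.
by rewrite derive_atan; [rewrite expr2|exact: df].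
Qed.

End Ck.

(** The coordinate directions of the space of parameters [(s, (u, t))]: position
    on a leaf, leaf, time. *)
Definition ds : R * (R * R) := (1, (0, 0)).
Definition du : R * (R * R) := (0, (1, 0)).
Definition dt : R * (R * R) := (0, (0, 1)).

Lemma derive_coord3 (W : normedModType R) (g : R * (R * R) -> W) x a b c :
  differentiable g x ->
  'D_(a, (b, c)) g x = a *: 'D_ds g x + b *: 'D_du g x + c *: 'D_dt g x.
Proof.
move=> dg.
have -> : (a, (b, c)) = a *: ds + b *: du + c *: dt.
  by congr (_, (_, _)) => /=; rewrite /GRing.scale/= !mulr0 mulr1 ?addr0 ?add0r.
by rewrite 2?derive_dirD// 3?derive_dirZ.
Qed.

Lemma derive_coord2 (W : normedModType R) (g : R * R -> W) x a b :
  differentiable g x ->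
  'D_(a, b) g x = a *: 'D_(e1 R) g x + b *: 'D_(e2 R) g x.
Proof.
move=> dg.
have -> : (a, b) = a *: e1 R + b *: e2 R.
  by congr (_, _) => /=; rewrite /GRing.scale/= mulr0 mulr1 ?addr0 ?add0r.
by rewrite derive_dirD// 2?derive_dirZ.
Qed.

Section Comp3.
Variable V : normedModType R.

Lemma derive_comp3 (g : R * (R * R) -> R) (a b c : V -> R) x v :
  differentiable a x -> differentiable b x -> differentiable c x ->
  differentiable g (a x, (b x, c x)) ->
  'D_v (fun y => g (a y, (b y, c y))) x =
  'D_v a x * 'D_ds g (a x, (b x, c x)) + 'D_v b x * 'D_du g (a x, (b x, c x))
  + 'D_v c x * 'D_dt g (a x, (b x, c x)).
Proof.
move=> da db dc dg; pose h y := (a y, (b y, c y)).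
have dh : differentiable h x.
  by apply: differentiable_pair => //; exact: differentiable_pair.
rewrite deriveE; last exact: (@differentiable_comp _ _ _ _ h g).
rewrite (@diff_comp _ _ _ _ h g)//= diff_pair//=; last exact: differentiable_pair.
by rewrite diff_pair//= -!deriveE// derive_coord3.
Qed.

(** The chain rule writes the derivative of the composite as a sum of products of
    derivatives of [a], [b], [c] by composites of partial derivatives of [g], and
    the latter are covered by the induction hypothesis because [g] is
    quantified. *)
Lemma Ck_comp3 k (O : set V) O' (g : R * (R * R) -> R) (a b c : V -> R) :
  open O -> Ck k O a -> Ck k O b -> Ck k O c -> Ck k O' g ->
  (forall x, O x -> O' (a x, (b x, c x))) ->
  Ck k O (fun x => g (a x, (b x, c x))).
Proof.
move=> oO; elim: k g a b c => [|k IH] g a b c aC bC cC gC OO'.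
  move=> x Ox; apply: (@continuous_comp _ _ _ (fun y => (a y, (b y, c y))) g).
    exact: (cvg_pair (aC x Ox) (cvg_pair (bC x Ox) (cC x Ox))).
  by apply: gC; exact: OO'.
have [[da Da] [db Db]] := (aC, bC).
have [[dc Dc] [dg Dg]] := (cC, gC).
split=> [x Ox|v].
  apply: (@differentiable_comp _ _ _ _ (fun y => (a y, (b y, c y))) g).
    apply: differentiable_pair; first exact: da.
    by apply: differentiable_pair; [exact: db|exact: dc].
  by apply: dg; exact: OO'.
have gI w := IH _ _ _ _ (CkS aC) (CkS bC) (CkS cC) (Dg w) OO'.
have := Ck_add oO (Ck_add oO (Ck_mul oO (Da v) (gI ds)) (Ck_mul oO (Db v) (gI du)))
  (Ck_mul oO (Dc v) (gI dt)).
apply: Ck_eq => // x /set_mem Ox.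
rewrite derive_comp3//; [exact: da|exact: db|exact: dc|].
by apply: dg; exact: OO'.
Qed.

End Comp3.
End Calculus.

(** * Completeness of a product *)

(* Products have to be seen as pointed filtered spaces for [cvg] to make sense. *)
HB.saturate prod.

Lemma cauchy_cvg_pair (R : realType) (V W : completeNormedModType R)
    (F : set_system (V * W)) :
  ProperFilter F -> cauchy F -> cvg F.
Proof.
move=> PF /cauchy_ballP cF.
have c1 : cvg (fst @ F).
  apply: cauchy_cvg; apply/cauchy_ballP => e e0.
  have [[A B] [/= FA FB] AB] := cF e e0; exists (fst @` A, fst @` B).
    by split; [apply: filterS FA => x|apply: filterS FB => x] => ?; exists x.
  by move=> [a b] /= [[x Ax <-] [y By <-]]; have [] := AB (x, y) (conj Ax By).
have c2 : cvg (snd @ F).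
  apply: cauchy_cvg; apply/cauchy_ballP => e e0.
  have [[A B] [/= FA FB] AB] := cF e e0; exists (snd @` A, snd @` B).
    by split; [apply: filterS FA => x|apply: filterS FB => x] => ?; exists x.
  by move=> [a b] /= [[x Ax <-] [y By <-]]; have [] := AB (x, y) (conj Ax By).
apply/cvg_ex; exists (lim (fst @ F), lim (snd @ F)).
apply: cvg_trans (cvg_pair c1 c2) => A FA.
have {}FA : F (fun x => A (x.1, x.2)) by [].
by apply: filterS FA => -[].
Qed.

HB.instance Definition _ (R : realType) (V W : completeNormedModType R) :=
  Uniform_isComplete.Build (V * W)%type (@cauchy_cvg_pair R V W).

(** * Mean value inequality and symmetry of second derivatives *)

Section MeanValue.
Context {R : realType}.

Lemma is_derive_line (V W : normedModType R) (g : V -> W) (v y : V) (s : R) :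
  differentiable g (s *: v + y) ->
  is_derive s 1 (fun h : R => g (h *: v + y)) ('D_v g (s *: v + y)).
Proof.
move=> dg; apply: (@is_derive_comp_curve _ _ _ g (fun h : R => h *: v + y)) => //.
have dl : differentiable (fun h : R => h *: v) s by [].
have := differentiable_is_derive (1 : R) dl; rewrite deriveE// diff_val scale1r => dlv.
by rewrite -[v in is_derive _ _ _ v]addr0; apply: is_deriveD.
Qed.

Lemma lipschitz_segment (V : normedModType R) (g : V -> R) (a b : V) C :
  (forall s : R, 0 <= s <= 1 -> differentiable g (s *: (b - a) + a)) ->
  (forall s : R, 0 <= s <= 1 -> `|'D_(b - a) g (s *: (b - a) + a)| <= C) ->
  `|g b - g a| <= C.
Proof.
move=> dg gC; pose h s := g (s *: (b - a) + a).
have [||c] := @MVT_segment R h (fun s => 'D_(b - a) g (s *: (b - a) + a)) 0 1 ler01.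
- move=> s; rewrite in_itv/= => /andP[s0 s1]; apply: is_derive_line.
  by apply: dg; rewrite !ltW.
- apply: derivable_within_continuous => s; rewrite in_itv/= => s01.
  by have [] := is_derive_line (dg s s01).
rewrite in_itv/= => c01; rewrite /h scale1r subrK scale0r add0r subr0 mulr1 => ->.
exact: gC.
Qed.

Lemma differentiable_approx (V W : normedModType R) (g : V -> W) x e : 0 < e ->
  differentiable g x ->
  exists2 d, 0 < d & forall k : V, `|k| < d ->
    `|g (k + x) - g x - 'd g x k| <= e * `|k|.
Proof.
move=> e0 /diff_locallyP[_ /eqaddoP/(_ e e0)] /nbhs_normP[d /= d0 de].
exists d => // k kd; have := de k; rewrite /ball_/= sub0r normrN => /(_ kd).
by rewrite !fctE /= opprD addrA.
Qed.

(** The second difference of [g] over the parallelogram spanned by [h v] and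
    [h w] is [h^2 D_w D_v g] up to [o(h^2)]. By the mean value theorem along [v] it
    is [h] times a difference of two values of [D_v g] at distance [h w], and
    [D_v g] is affine up to first order at [x]. *)
Lemma second_difference (V : normedModType R) (g : V -> R) x v w e : 0 < e ->
  (\forall y \near x, differentiable g y) -> differentiable ('D_v g) x ->
  exists2 d, 0 < d & forall h : R, 0 < h < d ->
    `|(g (h *: v + (h *: w + x)) - g (h *: w + x)) - (g (h *: v + x) - g x)
      - h ^+ 2 * 'D_w ('D_v g) x| <= e * h ^+ 2.
Proof.
move=> e0 /nbhs_normP[d1 /= d10 dg] dDg.
(* The remainders of [D_v g] at the two points are bounded by multiples of
   [h (|v| + |w|)] and [h |v|]; the 1 only makes [M] positive. *)
pose M := 2 * `|v| + `|w| + 1.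
have M0 : 0 < M by rewrite ltr_wpDl.
have [d2 d20 Dg] := differentiable_approx (divr_gt0 e0 M0) dDg.
exists (Num.min d1 d2 / M); first by rewrite divr_gt0// lt_min d10.
move=> h /andP[h0]; rewrite ltr_pdivlMr// lt_min => /andP[hd1 hd2].
have small (s t : R) : 0 <= s <= h -> 0 <= t <= h ->
    `|s *: v + t *: w| <= h * (`|v| + `|w|).
  move=> /andP[s0 sh] /andP[t0 th]; rewrite (le_trans (ler_normD _ _))//.
  by rewrite !normrZ !ger0_norm// mulrDr lerD// ler_wpM2r.
have hM : h * (`|v| + `|w|) < h * M.
  rewrite ltr_pM2l// /M; have := normr_ge0 v; have := normr_ge0 w; lra.
have sd1 (s t : R) : 0 <= s <= h -> 0 <= t <= h -> `|s *: v + t *: w| < d1.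
  by move=> sh th; rewrite (le_lt_trans (small _ _ sh th))// (lt_trans hM).
have sd2 (s t : R) : 0 <= s <= h -> 0 <= t <= h -> `|s *: v + t *: w| < d2.
  by move=> sh th; rewrite (le_lt_trans (small _ _ sh th))// (lt_trans hM).
have hh : 0 <= h <= h by rewrite ltW/=.
have h00 : 0 <= (0 : R) <= h by rewrite lexx ltW.
have dgs (s t : R) : 0 <= s <= h -> 0 <= t <= h ->
    differentiable g (s *: v + (t *: w + x)).
  move=> sh th; apply: dg; rewrite /= distrC addrA addrK; exact: sd1.
have dgs0 (s : R) : 0 <= s <= h -> differentiable g (s *: v + x).
  by move=> sh; have := dgs s 0 sh h00; rewrite scale0r add0r.
pose phi (s : R) := g (s *: v + (h *: w + x)) - g (s *: v + x).
pose dphi (s : R) := 'D_v g (s *: v + (h *: w + x)) - 'D_v g (s *: v + x).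
have dphiE (s : R) : 0 <= s <= h -> is_derive s 1 phi (dphi s).
  move=> sh; apply: is_deriveB; apply: is_derive_line; first exact: dgs.
  exact: dgs0.
have [||s] := @MVT_segment R phi dphi 0 h (ltW h0).
- by move=> s; rewrite in_itv/= => /andP[s0 s1]; apply: dphiE; rewrite !ltW.
- apply: derivable_within_continuous => s; rewrite in_itv/= => s01.
  by have [] := dphiE s s01.
rewrite in_itv/= => sh; rewrite {1 2}/phi !scale0r !add0r subr0 => phiE.
rewrite (_ : _ - _ = (phi h - (g (h *: w + x) - g x)) - h ^+ 2 * 'D_w ('D_v g) x); last first.
  by rewrite /phi; ring.
have r1 := Dg _ (sd2 _ _ sh hh).
have r2 := Dg _ (sd2 _ _ sh h00).
rewrite phiE deriveE//.
have -> : dphi s * h - h ^+ 2 * 'd ('D_v g) x w =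
  h * (('D_v g (s *: v + h *: w + x) - 'D_v g x - 'd ('D_v g) x (s *: v + h *: w))
    - ('D_v g (s *: v + 0 *: w + x) - 'D_v g x - 'd ('D_v g) x (s *: v + 0 *: w))).
  rewrite /dphi scale0r addr0 addrA linearD !linearZ/=.
  rewrite /GRing.scale/=; ring.
rewrite normrM ger0_norm ?(ltW h0)// expr2 mulrCA ler_pM2l//.
rewrite (le_trans (ler_normB _ _))// (le_trans (lerD r1 r2))// -mulrDr.
rewrite -mulrA ler_pM2l// ler_pdivrMl//.
rewrite scale0r addr0 (le_trans (lerD (ler_normD _ _) (lexx _)))//.
rewrite !normrZ !(ger0_norm (ltW h0)).
case/andP: sh => s0 sh; rewrite ger0_norm//.
have := ler_wpM2r (normr_ge0 v) sh; rewrite /M; lra.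
Qed.

(** Young's form of Schwarz's theorem: the second difference is symmetric in [v]
    and [w], so both mixed derivatives are its limit after division by [h^2]. *)
Lemma derive_comm (V : normedModType R) (g : V -> R) x v w :
  (\forall y \near x, differentiable g y) ->
  differentiable ('D_v g) x -> differentiable ('D_w g) x ->
  'D_w ('D_v g) x = 'D_v ('D_w g) x.
Proof.
move=> dg dv dw; apply/eqP; rewrite -subr_eq0 -normr_le0.
apply/ler_addgt0Pr => e e0; rewrite add0r.
have e20 : 0 < e / 2 by rewrite divr_gt0.
have [d1 d10 H1] := second_difference w e20 dg dv.
have [d2 d20 H2] := second_difference v e20 dg dw.
pose h := Num.min d1 d2 / 2.
have h0 : 0 < h by rewrite divr_gt0// lt_min d10.
have hd : h < Num.min d1 d2 by rewrite ltr_pdivrMr// ltr_pMr ?ltr1n// lt_min d10.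
move: (hd); rewrite lt_min => /andP[hd1 hd2].
have := H1 h; rewrite h0 hd1 => /(_ isT) E1.
have := H2 h; rewrite h0 hd2 => /(_ isT) E2.
have h20 : 0 < h ^+ 2 by rewrite exprn_gt0.
rewrite -(ler_pM2l h20) -[X in X * `|_|](ger0_norm (ltW h20)) -normrM.
rewrite (_ : h ^+ 2 * e = e / 2 * h ^+ 2 + e / 2 * h ^+ 2); last by field.
apply: le_trans (lerD E2 E1).
apply: le_trans (ler_normB _ _); rewrite le_eqVlt; apply/orP; left; apply/eqP.
rewrite (addrCA (h *: w) (h *: v) x); congr (`|_|).
move: (g (h *: v + _)) (g (h *: v + x)) (g (h *: w + x)) (g x) => a b c d.
move: ('D_w _ x) ('D_v _ x) => p q; ring.
Qed.

End MeanValue.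

(** * Inverting a family of perturbations of the identity *)

Section ParametricInverse.
Context {R : realType}.

Lemma ball_segment (V : normedModType R) (y0 a b : V) (r s : R) :
  0 <= s <= 1 -> ball y0 r a -> ball y0 r b -> ball y0 r (s *: (b - a) + a).
Proof.
move=> /andP[s0 s1]; rewrite -!ball_normE /ball_/= => ya yb.
have -> : y0 - (s *: (b - a) + a) = s *: (y0 - b) + (1 - s) *: (y0 - a).
  rewrite scalerBl scale1r addrCA -scalerBr.
  rewrite (_ : y0 - b - (y0 - a) = a - b); last by rewrite opprB addrC subrKA.
  by rewrite opprD -scalerN opprB addrCA addrC.
rewrite (le_lt_trans (ler_normD _ _))// !normrZ ger0_norm// ger0_norm ?subr_ge0//.
have [->|sn0] := eqVneq s 0; first by rewrite mul0r add0r subr0 mul1r.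
have sp : 0 < s by rewrite lt_def sn0.
have : s * `|y0 - b| < s * r by rewrite ltr_pM2l.
have : (1 - s) * `|y0 - a| <= (1 - s) * r by rewrite ler_wpM2l ?subr_ge0// ltW.
lra.
Qed.

Lemma ler_norm_fst (V W : normedModType R) (p : V * W) : `|p.1| <= `|p|.
Proof. by rewrite prod_normE le_max lexx. Qed.

Lemma ler_norm_snd (V W : normedModType R) (p : V * W) : `|p.2| <= `|p|.
Proof. by rewrite prod_normE le_max lexx orbT. Qed.

(** By continuity the two partial derivatives stay below [e / 2] on a ball, which is
    convex, and the mean value inequality applies along segments at constant
    time. *)
Lemma strict_lipschitz_param (E : R * R * R -> R) (y0 : R * R) (t0 : R) O :
  open O -> O (y0, t0) -> Ck 1 O E ->
  'D_(e1 R, 0) E (y0, t0) = 0 -> 'D_(e2 R, 0) E (y0, t0) = 0 ->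
  forall e : R, 0 < e -> exists2 d, 0 < d & forall y1 y2 t,
    ball y0 d y1 -> ball y0 d y2 -> ball t0 d t ->
    `|E (y1, t) - E (y2, t)| <= e * `|y1 - y2|.
Proof.
move=> oO Oq [dE DE] E1 E2 e e0.
have e20 : 0 < e / 2 by rewrite divr_gt0.
have near_small v : 'D_v E (y0, t0) = 0 ->
    \forall q \near (y0, t0), `|'D_v E q| <= e / 2.
  move=> v0; have /cvgrPdist_le/(_ _ e20) := DE v _ Oq.
  by apply: filterS => q; rewrite v0 sub0r normrN.
have /nbhs_ballP[d /= d0 dP] :
    \forall q \near (y0, t0), [/\ O q, `|'D_(e1 R, 0) E q| <= e / 2 &
      `|'D_(e2 R, 0) E q| <= e / 2].
  apply: filterS3 (open_nbhs_nbhs (conj oO Oq)) (near_small _ E1) (near_small _ E2).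
  by move=> q.
exists d => // y1 y2 t By1 By2 Bt.
have seg (s : R) : 0 <= s <= 1 ->
    ball (y0, t0) d (s *: ((y1, t) - (y2, t)) + (y2, t)).
  move=> s01; split; first exact: ball_segment.
  by rewrite /= subrr scaler0 add0r.
apply: lipschitz_segment => s /seg; move: (_ + _) => z /dP[Oz z1 z2].
  exact: dE.
have -> : (y1, t) - (y2, t) =
    (y1 - y2).1 *: ((e1 R, 0) : R * R * R) + (y1 - y2).2 *: ((e2 R, 0) : R * R * R).
  congr (_, _); last by rewrite /= /GRing.scale/= !mulr0 addr0 subrr.
  by congr (_, _); rewrite /= /GRing.scale/= ?mulr0 ?mulr1 ?addr0 ?add0r.
have dEz := dE z Oz.
rewrite derive_dirD// !derive_dirZ// (le_trans (ler_normD _ _))//.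
rewrite [e in leRHS]splitr mulrDl; apply: lerD.
  by rewrite normrM mulrC (ler_pM (normr_ge0 _) (normr_ge0 _) z1 (ler_norm_fst _)).
by rewrite normrM mulrC (ler_pM (normr_ge0 _) (normr_ge0 _) z2 (ler_norm_snd _)).
Qed.

Section Inverse.
Variables (V : completeNormedModType R) (K : V * R -> V) (y0 : V) (t0 : R).
Variable O : set (V * R).
Hypothesis oO : open O.
Hypothesis Oq : O (y0, t0).
Hypothesis K0 : K (y0, t0) = y0.
Hypothesis Kc : forall q, O q -> {for q, continuous K}.
Hypothesis Klip : forall e : R, 0 < e -> exists2 d, 0 < d & forall y1 y2 t,
    ball y0 d y1 -> ball y0 d y2 -> ball t0 d t ->
    `|(K (y1, t) - y1) - (K (y2, t) - y2)| <= e * `|y1 - y2|.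

(** Solving [K (y, t) = z] means finding a fixed point of
    [y |-> z - (K (y, t) - y)], a contraction that maps the ball to itself. *)
Lemma param_fixpoint (r t : R) z :
  0 < r ->
  (forall y1 y2, closed_ball y0 r y1 -> closed_ball y0 r y2 ->
    `|(K (y1, t) - y1) - (K (y2, t) - y2)| <= 2^-1 * `|y1 - y2|) ->
  `|z - K (y0, t)| <= r / 2 ->
  exists2 y, closed_ball y0 r y & K (y, t) = z.
Proof.
move=> r0 Kr zr.
pose f y := z - (K (y, t) - y).
have fB : {homo f : y / closed_ball y0 r y >-> closed_ball y0 r y}.
  move=> y yr; have := yr; rewrite !closed_ballE//= /closed_ball_/= => yr'.
  have -> : y0 - f y = ((K (y, t) - y) - (K (y0, t) - y0)) - (z - K (y0, t)).
    by rewrite /f !opprB -[in RHS]addrA subrKA addrCA.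
  rewrite (le_trans (ler_normB _ _))// (splitr r) lerD//.
  apply: le_trans (Kr _ _ yr _) _; first exact: closed_ballxx.
  by rewrite distrC mulrC ler_wpM2r.
pose f' : {fun closed_ball y0 r >-> closed_ball y0 r} := mkfun fB.
have ctr : is_contraction f'.
  have h0 : 0 <= 2^-1 :> R by [].
  exists (NngNum h0); split => /=; first by rewrite invf_lt1// ltr1n.
  move=> [a b] /= [ar br].
  have -> : f a - f b = - ((K (a, t) - a) - (K (b, t) - b)).
    rewrite /f; move: (K (a, t) - a) (K (b, t) - b) => u v.
    by rewrite !opprB addrC subrKA.
  by rewrite normrN; exact: Kr.
have [||y yr fy] := banach_fixed_point ctr.
- exact: closed_ball_closed.
- by exists y0; exact: closed_ballxx.
have {}fy : y = z - (K (y, t) - y) := fy.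
exists y => //; move: fy; rewrite opprB addrCA -[LHS]addr0.
by move=> /addrI/esym/eqP; rewrite subr_eq0 => /eqP.
Qed.

(** An inverse function theorem that only asks for a strict derivative in [y], equal
    to the identity at [(y0, t0)]. Existence is [param_fixpoint]; uniqueness and
    continuity hold because [K (-, t)] contracts distances by a factor at most 2.
    Along [y = y0] the inverse moves with the opposite velocity of [K]: the
    estimate
    [|kinv (y0, t) - y0| <= 2 |K (y0, t) - y0|] makes the displacement of order
    [t - t0], so that the arbitrarily small Lipschitz constant turns the error
    into a [o(t - t0)]. *)
Lemma param_inverse : exists kinv : V * R -> V, exists N : set (V * R),
  [/\ open N, N (y0, t0),
     forall q, N q -> K (kinv q, q.2) = q.1,
     forall q, N q -> {for q, continuous kinv} &
     [/\ \forall y \near y0, N (y, t0) /\ (K (y, t0) = y -> kinv (y, t0) = y),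
     kinv (y0, t0) = y0 &
     forall H : V, is_derive t0 1 (fun t => K (y0, t)) H ->
       is_derive t0 1 (fun t => kinv (y0, t)) (- H)]].
Proof.
have h2 : 0 < 2^-1 :> R by [].
have [d d0 dK] := Klip h2.
have /nbhs_ballP[d' /= d'0 dO] := open_nbhs_nbhs (conj oO Oq).
pose r := Num.min d d' / 2.
have m0 : 0 < Num.min d d' by rewrite lt_min d0.
have r0 : 0 < r by rewrite divr_gt0.
have rm : r < Num.min d d' by rewrite ltr_pdivrMr// ltr_pMr// ltr1n.
have cB y : closed_ball y0 r y -> ball y0 d y /\ ball y0 d' y.
  rewrite closed_ballE//= /closed_ball_/= -!ball_normE /ball_/= => yr.
  by have := le_lt_trans yr rm; rewrite lt_min => /andP.
have rB t : ball t0 r t -> ball t0 d t /\ ball t0 d' t.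
  rewrite -!ball_normE /ball_/= => tr.
  by have := lt_trans tr rm; rewrite lt_min => /andP.
have Kr t y1 y2 : ball t0 r t -> closed_ball y0 r y1 -> closed_ball y0 r y2 ->
    `|(K (y1, t) - y1) - (K (y2, t) - y2)| <= 2^-1 * `|y1 - y2|.
  by move=> /rB[t1 _] /cB[Y1 _] /cB[Y2 _]; exact: dK.
(* Since [K - id] has Lipschitz constant 1/2, [K (-, t)] contracts distances by a
   factor at most 2. *)
have inj t y1 y2 : ball t0 r t -> closed_ball y0 r y1 -> closed_ball y0 r y2 ->
    `|y1 - y2| <= 2 * `|K (y1, t) - K (y2, t)|.
  move=> tr Y1 Y2; have := Kr _ _ _ tr Y1 Y2.
  have -> : y1 - y2 = (K (y1, t) - K (y2, t)) -
      ((K (y1, t) - y1) - (K (y2, t) - y2)).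
    rewrite (_ : K (y1, t) - y1 - _ = (K (y1, t) - K (y2, t)) - (y1 - y2)).
      by rewrite opprB addrCA subrr addr0.
    by rewrite opprD addrACA -opprD.
  set a := K (y1, t) - K (y2, t); set b := _ - (K (y2, t) - y2) => ab.
  have := ler_normB a b; lra.
pose S : set (V * R) := [set q | ball t0 r q.2 /\ `|q.1 - K (y0, q.2)| < r / 2].
have KO y t : closed_ball y0 r y -> ball t0 r t -> {for (y, t), continuous K}.
  by move=> /cB[_ Y] /rB[_ tr]; apply: Kc; exact: dO.
have y0r : closed_ball y0 r y0 by exact: closed_ballxx.
have t0r : ball t0 r t0 by exact: ballxx.
have KyC y q : closed_ball y0 r y -> ball t0 r q.2 ->
    (fun q' : V * R => q'.1 - K (y, q'.2)) @ q --> q.1 - K (y, q.2).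
  move=> yr tr; apply: cvgB; first exact: continuous_fst.
  apply: (@continuous_comp _ _ _ (fun q' : V * R => (y, q'.2)) K).
    exact: (cvg_pair (cvg_cst y) (@continuous_snd _ _ q)).
  exact: KO.
have S_nbhs q : S q -> nbhs q S.
  move=> [tr zr].
  have n1 : \forall q' \near q, ball t0 r q'.2.
    by apply: (@continuous_snd _ _ q); apply: open_nbhs_nbhs; split => //; exact: ball_open.
  have n2 : \forall q' \near q, `|q'.1 - K (y0, q'.2)| < r / 2.
    exact: cvgr_norm_lt (KyC _ _ y0r tr) _ zr.
  exact: filterI n1 n2.
have oS : open S by rewrite openE => q /S_nbhs.
have S0 : S (y0, t0) by split => //=; rewrite K0 subrr normr0 divr_gt0.
have ex q : exists y, S q -> closed_ball y0 r y /\ K (y, q.2) = q.1.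
  have [[tr zr]|nS] := pselect (S q); last by exists y0.
  have [||y yr Ky] := @param_fixpoint r q.2 q.1 r0; last by exists y.
  - by move=> y1 y2; exact: Kr.
  - exact: ltW.
pose kinv q := sval (cid (ex q)).
have kinvP q : S q -> closed_ball y0 r (kinv q) /\ K (kinv q, q.2) = q.1.
  by rewrite /kinv; case: cid.
have kinv0 : kinv (y0, t0) = y0.
  have [k1 k2] := kinvP _ S0.
  apply/eqP; rewrite -subr_eq0 -normr_le0.
  by rewrite (le_trans (inj t0 _ _ t0r k1 y0r))// k2/= K0 subrr normr0 mulr0.
have kinvC q : S q -> {for q, continuous kinv}.
  move=> Sq.
  have [k1 k2] := kinvP q Sq; have [tr _] := Sq.
  apply/cvgrPdist_le => e e0.
  have cE : (fun q' : V * R => q'.1 - K (kinv q, q'.2)) @ q --> (0 : V).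
    by rewrite -(subrr q.1) -{2}k2; exact: KyC.
  have e2 : 0 < e / 2 by rewrite divr_gt0.
  have := S_nbhs q Sq; move/cvgrPdist_le: cE => /(_ _ e2).
  apply: filterS2 => q' qe Sq'; have [k1' k2'] := kinvP q' Sq'.
  have [tr' _] := Sq'.
  rewrite distrC (le_trans (inj _ _ _ tr' k1' k1))// k2'.
  move: qe; rewrite sub0r normrN; lra.
exists kinv, S; split => // [q /kinvP[]//|]; split => //.
- have : \forall y \near y0, S (y, t0).
    have c : (fun y : V => (y, t0)) @ y0 --> (y0, t0).
      exact: (cvg_pair cvg_id (cvg_cst t0)).
    by apply: c; exact: S_nbhs.
  have : \forall y \near y0, closed_ball y0 r y.
    exact: filterS (@subset_closed_ball _ _ _ _) (nbhsx_ballx y0 r r0).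
  apply: filterS2 => y yr Sy; split => // Ky.
  have [k1 k2] := kinvP _ Sy.
  apply/eqP; rewrite -subr_eq0 -normr_le0.
  by rewrite (le_trans (inj t0 _ _ t0r k1 yr))// k2/= Ky subrr normr0 mulr0.
move=> H [dK' KH].
suff cv : h^-1 *: (kinv (y0, h *: 1 + t0) - kinv (y0, t0)) @[h --> 0^'] --> - H.
  by apply: DeriveDef; [apply/cvg_ex; exists (- H)|exact: cvg_lim cv].
have cK : h^-1 *: (K (y0, h *: 1 + t0) - K (y0, t0)) @[h --> 0^'] --> H.
  by rewrite -KH.
rewrite kinv0; rewrite K0 in cK.
have line0 : (fun h : R => h *: 1 + t0) @ 0^' --> t0.
  apply: cvg_trans (_ : (fun h : R => h *: 1 + t0) @ (0 : R) --> t0).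
    by apply: cvg_app; exact: nbhs_dnbhs.
  rewrite -[X in _ --> X](add0r t0) -[X in _ --> X + _](scale0r (1 : R)).
  by apply: cvgD; [exact: scalel_continuous|exact: cvg_cst].
have curve0 : (fun h : R => (y0, h *: 1 + t0)) @ 0^' --> (y0, t0).
  exact: (cvg_pair (cvg_cst y0) line0).
apply/cvgrPdist_le => e e0.
pose C := `|H| + 1.
have C0 : 0 < C by rewrite ltr_wpDl.
have e20 : 0 < e / 2 by rewrite divr_gt0.
have ec : 0 < e / (4 * C) by rewrite divr_gt0// mulr_gt0.
have [de de0 Kde] := Klip ec.
have n1 : \forall h \near 0^', h != 0 :> R by exact: nbhs_dnbhs_neq.
have n2 : \forall h \near 0^', ball t0 de (h *: 1 + t0).
  by have := line0 _ (nbhsx_ballx t0 de de0).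
have n3 : \forall h \near 0^', S (y0, h *: 1 + t0) by have := curve0 _ (S_nbhs _ S0).
have n4 : \forall h \near 0^', ball y0 de (kinv (y0, h *: 1 + t0)).
  have := cvg_comp _ _ curve0 (kinvC _ S0); rewrite kinv0.
  by move=> /(_ _ (nbhsx_ballx y0 de de0)).
have n5 : \forall h \near 0^',
    `|H - h^-1 *: (K (y0, h *: 1 + t0) - y0)| <= e / 2.
  by move/cvgrPdist_le: cK => /(_ _ e20).
have n6 : \forall h \near 0^', `|h^-1 *: (K (y0, h *: 1 + t0) - y0)| < C.
  by apply: (cvgr_norm_lt _ cK); rewrite ltr_pwDr.
near=> h.
have h0 : h != 0 by near: h.
have tde : ball t0 de (h *: 1 + t0) by near: h.
have Sh : S (y0, h *: 1 + t0) by near: h.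
have kde : ball y0 de (kinv (y0, h *: 1 + t0)) by near: h.
have Q1 : `|H - h^-1 *: (K (y0, h *: 1 + t0) - y0)| <= e / 2 by near: h.
have Q2 : `|h^-1 *: (K (y0, h *: 1 + t0) - y0)| < C by near: h.
have [k1 k2] := kinvP _ Sh; have [tr _] := Sh.
rewrite /= in k1 k2 tr.
set t := h *: 1 + t0 in tde Sh kde Q1 Q2 k1 k2 tr *.
set z := kinv (y0, t) in kde k1 k2 *; set k := K (y0, t) in Q1 Q2 *.
pose a := (K (z, t) - z) - (k - y0).
have ae : `|a| <= e / (4 * C) * `|z - y0| by apply: Kde => //; exact: ballxx.
have zk : `|z - y0| <= 2 * `|k - y0|.
  by rewrite (le_trans (inj t _ _ tr k1 y0r))// k2 distrC.
have zE : z - y0 = - a - (k - y0).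
  by rewrite /a k2 [X in X - _]opprB addrAC subrr add0r opprB.
have -> : - H - h^-1 *: (z - y0) = - (H - h^-1 *: (k - y0)) + h^-1 *: a.
  by rewrite zE (scalerBr _ (- a)) scalerN !opprB opprK addrA [- H + _]addrC.
rewrite (le_trans (ler_normD _ _))// normrN [e]splitr lerD//.
have Q3 : `|h^-1| * `|k - y0| <= C by rewrite -normrZ ltW.
rewrite normrZ (le_trans (ler_wpM2l (normr_ge0 _) ae))//.
rewrite mulrCA (le_trans (ler_wpM2l (ltW ec) (ler_wpM2l (normr_ge0 _) zk)))//.
rewrite (mulrCA _ 2) (le_trans (ler_wpM2l (ltW ec) (ler_wpM2l _ Q3)))//.
rewrite le_eqVlt; apply/orP; left; apply/eqP; field.
by rewrite gt_eqF.
Unshelve. all: by end_near.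
Qed.

End Inverse.
End ParametricInverse.

(** * Angles *)

Section Angles.
Context {R : realType}.

Lemma to_angleP (a b : R) :
  to_angle a = to_angle b <-> exists k : int, a - b = k%:~R * (2 * pi).
Proof.
have E : (a - b \in @two_pi_int R) = (to_angle a == to_angle b).
  exact: Quotient.idealrBE.
split=> [/eqP|abk]; first by rewrite -E => /asboolP.
by apply/eqP; rewrite -E; apply/asboolP.
Qed.

Lemma trig_shift_int (x : R) (k : int) :
  cos (x + k%:~R * (2 * pi)) = cos x /\ sin (x + k%:~R * (2 * pi)) = sin x.
Proof.
have nat_shift (n : nat) (y : R) :
    cos (y + n%:R * (2 * pi)) = cos y /\ sin (y + n%:R * (2 * pi)) = sin y.
  have -> : n%:R * (2 * pi) = (pi *+ 2) *+ n :> R.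
    by rewrite mulr_natl mulr_natl.
  by rewrite (periodicn (@cosD2pi R)) (periodicn (@sinD2pi R)).
case: k => n; first exact: nat_shift.
rewrite NegzE; have := nat_shift n.+1 (x + (- n.+1%:Z)%:~R * (2 * pi)).
by rewrite mulrNz mulNr subrK => -[-> ->].
Qed.

(** After subtraction of a multiple of [2 pi] the angle is [y] in [0, 2 pi[, and
    [cos y = 1 - 2 sin^2 (y / 2)], where [sin (y / 2)] vanishes only for [y = 0]. *)
Lemma cos_eq1_2pi (x : R) : cos x = 1 -> exists k : int, x = k%:~R * (2 * pi).
Proof.
move=> cx; pose k := Num.floor (x / (2 * pi)).
have p0 : 0 < 2 * pi :> R by rewrite mulr_gt0// pi_gt0.
pose y := x - k%:~R * (2 * pi).
have y0 : 0 <= y by rewrite subr_ge0 -ler_pdivlMr// ge_floor.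
have y1 : y < 2 * pi.
  rewrite ltrBlDr (_ : _ + _ = (k%:~R + 1) * (2 * pi)); last by ring.
  rewrite -ltr_pdivrMr//.
  by have := floorD1_gt (x / (2 * pi)); rewrite intrD.
have cy : cos y = 1.
  have [cE _] := trig_shift_int y k.
  by rewrite -cE /y subrK.
have [y00|yn0] := eqVneq y 0.
  by exists k; apply/eqP; rewrite -subr_eq0; apply/eqP.
have s0 : 0 < sin (y / 2).
  have yp : 0 < y by rewrite lt_def yn0.
  by rewrite sin_gt0_pi// divr_gt0//= ltr_pdivrMr// mulrC.
have : cos (y / 2 *+ 2) = 1 by rewrite -[_ *+ 2]mulr_natr divfK.
rewrite cos_mulr2n cos2sin2 => E.
have := mulr_gt0 s0 s0; rewrite -expr2; move: E; rewrite mulr2n; lra.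
Qed.

Lemma to_angle_trig (a b : R) :
  to_angle a = to_angle b <-> cos a = cos b /\ sin a = sin b.
Proof.
split=> [/to_angleP[k abk]|[ca sa]].
  have -> : a = b + k%:~R * (2 * pi) by rewrite -abk addrC subrK.
  exact: trig_shift_int.
apply/to_angleP/cos_eq1_2pi.
by rewrite cosB ca sa -!expr2 cos2Dsin2.
Qed.

(** The determination, close to [r0], of the angle of the vector [(v1, v2)]: after
    a rotation by [- r0] the vector lies in a right half-plane, where the arc
    tangent of the slope is a smooth determination of the angle. *)
Definition angle_near (r0 v1 v2 : R) : R :=
  r0 + atan ((cos r0 * v2 - sin r0 * v1) / (cos r0 * v1 + sin r0 * v2)).

(** The angles [r - r0] and [atan (tan (r - r0))] have the same tangent and both
    have a positive cosine, hence they have the same cosine and the same sine. *)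
Lemma angle_nearP (r0 v1 v2 n r : R) : 0 <= n ->
  v1 = n * cos r -> v2 = n * sin r -> 0 < cos r0 * v1 + sin r0 * v2 ->
  to_angle (angle_near r0 v1 v2) = to_angle r.
Proof.
move=> n0 v1E v2E P0.
have PE : cos r0 * v1 + sin r0 * v2 = n * cos (r - r0).
  by rewrite v1E v2E cosB; ring.
have QE : cos r0 * v2 - sin r0 * v1 = n * sin (r - r0).
  by rewrite v1E v2E sinB; ring.
have np : 0 < n.
  by rewrite lt_def n0 andbT; apply: contraTneq P0 => n00; rewrite PE n00 mul0r ltxx.
have c0 : 0 < cos (r - r0) by rewrite -(pmulr_rgt0 _ np) -PE.
rewrite /angle_near PE QE -mulf_div divff ?gt_eqF// mul1r -/(tan _).
set d := r - r0 in c0 *; set t := atan (tan d).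
have ct : 0 < cos t by rewrite cos_gt0_pihalf// atan_gtNpi2 atan_ltpi2.
have tt : tan t = tan d by exact: atanK.
have cc : cos t = cos d.
  apply/eqP; rewrite -(@eqrXn2 _ 2) ?ltW//; apply/eqP/invr_inj.
  by rewrite !cos2_tan2 ?gt_eqF// tt.
have ss : sin t = sin d.
  move: tt; rewrite /tan cc => /(congr1 (fun x => x * cos d)).
  by rewrite !divfK ?gt_eqF.
have -> : r = r0 + d by rewrite /d addrC subrK.
by apply/to_angle_trig; rewrite 2!cosD 2!sinD cc ss.
Qed.

Lemma is_derive_mulr (V : normedModType R) (f g : V -> R) x v df dg :
  is_derive x v f df -> is_derive x v g dg ->
  is_derive x v (fun y => f y * g y) (df * g x + f x * dg).
Proof.
move=> Hf Hg; apply: (is_derive_eq (is_deriveM Hf Hg)).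
by rewrite /GRing.scale/= addrC [in LHS]mulrC.
Qed.

Lemma is_derive_divr (V : normedModType R) (f g : V -> R) x v df dg :
  g x != 0 -> is_derive x v f df -> is_derive x v g dg ->
  is_derive x v (fun y => f y / g y) ((df * g x - f x * dg) / g x ^+ 2).
Proof.
move=> g0 Hf [Hg gE].
have Hi : is_derive x v (fun y => (g y)^-1) (- (g x) ^- 2 * dg).
  by apply: DeriveDef; [exact: derivableV|rewrite deriveV// gE].
by apply: (is_derive_eq (is_derive_mulr Hf Hi)); field.
Qed.

(** The derivative does not see the reference angle, because the rotation by
    [- r0] preserves both the determinant and the squared norm. *)
Lemma derive_angle_near (V : normedModType R) r0 (v1 v2 : V -> R) x h :
  differentiable v1 x -> differentiable v2 x ->
  cos r0 * v1 x + sin r0 * v2 x != 0 ->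
  'D_h (fun y => angle_near r0 (v1 y) (v2 y)) x =
  (v1 x * 'D_h v2 x - v2 x * 'D_h v1 x) / (v1 x ^+ 2 + v2 x ^+ 2).
Proof.
move=> d1 d2 P0.
have D1 := differentiable_is_derive h d1.
have D2 := differentiable_is_derive h d2.
have Dc (a : R) (w : V -> R) : is_derive x h w ('D_h w x) ->
    is_derive x h (fun y => a * w y) (a * 'D_h w x).
  by move=> Hw; exact: is_deriveZ.
pose P y := cos r0 * v1 y + sin r0 * v2 y.
pose Q y := cos r0 * v2 y - sin r0 * v1 y.
have DP : is_derive x h P (cos r0 * 'D_h v1 x + sin r0 * 'D_h v2 x).
  exact: is_deriveD (Dc _ _ D1) (Dc _ _ D2).
have DQ : is_derive x h Q (cos r0 * 'D_h v2 x - sin r0 * 'D_h v1 x).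
  exact: is_deriveB (Dc _ _ D2) (Dc _ _ D1).
have Dq := is_derive_divr (g := P) P0 DQ DP.
have dQP : differentiable (fun y => Q y / P y) x.
  have dcst (a : R) : differentiable (fun=> a : R) x by exact: differentiable_cst.
  apply: differentiableM; last apply: differentiableV => //.
    by apply: differentiableB; apply: differentiableM.
  by apply: differentiableD; apply: differentiableM.
rewrite /angle_near deriveD//; last first.
  by apply: diff_derivable; exact: differentiable_atan.
rewrite derive_cst add0r derive_atan//.
have [_ ->] := Dq; rewrite -/(P x) -/(Q x).
have nE : v1 x ^+ 2 + v2 x ^+ 2 = P x ^+ 2 + Q x ^+ 2.
  have := cos2Dsin2 r0; rewrite /P /Q => E.
  rewrite -[LHS]mul1r -E; ring.
have N0 : P x ^+ 2 + Q x ^+ 2 != 0.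
  by rewrite gt_eqF// ltr_pwDl ?sqr_ge0// exprn_even_gt0.
have -> : v1 x * 'D_h v2 x - v2 x * 'D_h v1 x =
    (cos r0 * 'D_h v2 x - sin r0 * 'D_h v1 x) * P x
    - Q x * (cos r0 * 'D_h v1 x + sin r0 * 'D_h v2 x).
  have := cos2Dsin2 r0; rewrite /P /Q => E.
  rewrite -[LHS]mul1r -E; ring.
rewrite nE; move: P0 N0; rewrite -/(P x); move: (P x) (Q x) => p q p0 n0.
by field; rewrite p0 n0.
Qed.

Lemma Ck_angle_near (V : normedModType R) k (O : set V) r0 (v1 v2 : V -> R) :
  open O -> Ck k O v1 -> Ck k O v2 ->
  (forall x, O x -> cos r0 * v1 x + sin r0 * v2 x != 0) ->
  Ck k O (fun y => angle_near r0 (v1 y) (v2 y)).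
Proof.
move=> oO c1 c2 P0.
apply: Ck_add => //; first exact: Ck_cst.
apply: Ck_atan => //; apply: Ck_mul => //.
  by apply: Ck_subr => //; apply: Ck_mul => //; exact: Ck_cst.
apply: Ck_inv => //.
by apply: Ck_add => //; apply: Ck_mul => //; exact: Ck_cst.
Qed.

End Angles.

(** * The evolution of the angle along a leaf *)

(** The last step of the evolution equation below, in terms of the velocity
    [(v, w)] of the leaf, its acceleration [(a, b)], the gradient [(p, r)] and the
    Hessian of the angle function, with [q] the ratio between the mean curvature
    vector and the rotated velocity [(- w, v)], and [dq] its derivative along the
    leaf. *)
Lemma evolution_algebra (R : realFieldType)
    (v w a b p r f11 f12 f22 n q dq : R) :
  n = v ^+ 2 + w ^+ 2 -> n != 0 -> v * b - w * a = n * (v * p + w * r) ->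
  q = (v * p + w * r) / n ->
  dq = ((a * p + v * (v * f11 + w * f12) + (b * r + w * (v * f12 + w * f22))) * n
      - (v * p + w * r) * (2 * (v * a + w * b))) / n ^+ 2 ->
  (v * (dq * v + q * a) - w * - (dq * w + q * b)) / n =
  (f11 * v ^+ 2 + 2 * f12 * v * w + f22 * w ^+ 2) / n
    + p * - (q * w) + r * (q * v).
Proof.
move=> nE n0 curv qE dqE.
(* The acceleration is decomposed on the velocity and on the rotated velocity;
   its normal component is the curvature. *)
have E : n * (a * p + b * r) =
    (v * a + w * b) * (v * p + w * r) + n * (v * p + w * r) * (v * r - w * p).
  by rewrite -curv nE; ring.
rewrite (_ : (_ - _) / n = dq + q * (v * a + w * b) / n); last first.
  rewrite (_ : v * _ - _ = dq * n + q * (v * a + w * b)); last by rewrite nE; ring.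
  by field.
have -> : dq = (v * (v * f11 + w * f12) + w * (v * f12 + w * f22)) / n
   + n * (a * p + b * r) / n ^+ 2 - 2 * (v * p + w * r) * (v * a + w * b) / n ^+ 2.
  by rewrite dqE; field.
rewrite E qE; field; exact: n0.
Qed.

(** Here [(G1, G2)] is the foliation in a chart, [alpha] the angle of its leaves in
    this chart, and [f] the same angle as a function of the plane at time [t0];
    [v] and [a] are the velocity and the acceleration of the leaves. *)
Section Evolution.
Context {R : realType}.
Variables (G1 G2 alpha : R * (R * R) -> R) (s0 u0 t0 : R).
Variables (f : R * R -> R) (O : set (R * (R * R))) (O' : set (R * R)).
Let curve (s : R) : R * (R * R) := (s, (u0, t0)).
Let x0 := curve s0.
Let y0 : R * R := (G1 x0, G2 x0).
Let v1 := 'D_(@ds R) G1.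
Let v2 := 'D_(@ds R) G2.
Let a1 := 'D_(@ds R) v1.
Let a2 := 'D_(@ds R) v2.
Let n x := v1 x ^+ 2 + v2 x ^+ 2.
Let f1 := 'D_(e1 R) f.
Let f2 := 'D_(e2 R) f.

Hypothesis oO : open O.
Hypothesis Ox0 : O x0.
Hypothesis G1C : Ck 3 O G1.
Hypothesis G2C : Ck 3 O G2.
Hypothesis n0 : forall x, O x -> n x != 0.
Hypothesis alpha_diff : forall x, O x -> differentiable alpha x.
Hypothesis alphaE : forall x h, O x ->
  'D_h alpha x = (v1 x * 'D_h v2 x - v2 x * 'D_h v1 x) / n x.
Hypothesis oO' : open O'.
Hypothesis Oy0 : O' y0.
Hypothesis fC : Ck 2 O' f.
Hypothesis falpha : \forall s \near s0, f (G1 (curve s), G2 (curve s)) = alpha (curve s).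
Hypothesis mcf1 : \forall s \near s0, 'D_(@dt R) G1 (curve s) =
  - ((v1 (curve s) * a2 (curve s) - v2 (curve s) * a1 (curve s)) / n (curve s) ^+ 2 * v2 (curve s)).
Hypothesis mcf2 : \forall s \near s0, 'D_(@dt R) G2 (curve s) =
  (v1 (curve s) * a2 (curve s) - v2 (curve s) * a1 (curve s)) / n (curve s) ^+ 2 * v1 (curve s).

Let is_derive_curve (W : normedModType R) (g : R * (R * R) -> W) (s : R) :
  differentiable g (curve s) ->
  is_derive s 1 (fun s => g (curve s)) ('D_(@ds R) g (curve s)).
Proof.
move=> dg; apply: (@is_derive_comp_curve _ _ _ g curve) => //.
by apply: is_derive_pair; exact: is_derive_id.
Qed.

Let is_derive_leaf (g : R * R -> R) (s : R) :
  O (curve s) -> differentiable g (G1 (curve s), G2 (curve s)) ->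
  is_derive s 1 (fun s => g (G1 (curve s), G2 (curve s)))
    (v1 (curve s) * 'D_(e1 R) g (G1 (curve s), G2 (curve s)) +
     v2 (curve s) * 'D_(e2 R) g (G1 (curve s), G2 (curve s))).
Proof.
move=> Os dg.
have := @is_derive_comp_curve _ _ _ g (fun s => (G1 (curve s), G2 (curve s))) s
  (v1 (curve s), v2 (curve s)).
rewrite derive_coord2//; apply => //.
apply: is_derive_pair; apply: is_derive_curve.
- exact: Ck_differentiable G1C Os.
- exact: Ck_differentiable G2C Os.
Qed.

Let near_O : \forall s \near s0, O (curve s).
Proof.
have c : (fun s : R => curve s) @ s0 --> x0.
  exact: (cvg_pair cvg_id (cvg_cst (u0, t0))).
exact: c _ (open_nbhs_nbhs (conj oO Ox0)).
Qed.

Let cvg_leaf : (fun s : R => (G1 (curve s), G2 (curve s))) @ s0 --> y0.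
Proof.
have c (g : R * (R * R) -> R) : Ck 3 O g -> (fun s => g (curve s)) @ s0 --> g x0.
  move=> gC; have [d _] := is_derive_curve (Ck_differentiable gC Ox0).
  exact/differentiable_continuous/derivable1_diffP.
exact: (cvg_pair (c _ G1C) (c _ G2C)).
Qed.

(** The derivative of the angle along the leaf is, on the one hand, the
    determinant of velocity and acceleration over the squared speed, and on the
    other hand the derivative of [f] in the direction of the velocity. *)
Let curvature_near : \forall s \near s0,
  v1 (curve s) * a2 (curve s) - v2 (curve s) * a1 (curve s) =
  n (curve s) * (v1 (curve s) * f1 (G1 (curve s), G2 (curve s)) +
    v2 (curve s) * f2 (G1 (curve s), G2 (curve s))).
Proof.
have near_O' : \forall s \near s0, O' (G1 (curve s), G2 (curve s)).
  exact: cvg_leaf _ (open_nbhs_nbhs (conj oO' Oy0)).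
have falpha2 := near_join falpha.
near=> s.
have Os : O (curve s) by near: s.
have Os' : O' (G1 (curve s), G2 (curve s)) by near: s.
have fas : \forall z \near s, f (G1 (curve z), G2 (curve z)) = alpha (curve z).
  by near: s.
have D1 := is_derive_leaf Os (Ck_differentiable fC Os').
have D2 := is_derive_curve (alpha_diff Os).
have [_ E1] := near_eq_is_derive fas D1; have [_ E2] := D2.
have := alphaE (@ds R) Os; rewrite -/v1 -/v2 -/a1 -/a2 -E2 E1 => E.
by rewrite E [RHS]mulrC divfK//; exact: n0.
Unshelve. all: by end_near.
Qed.

(** The ratio between the mean curvature vector and the rotated velocity,
    expressed with the first derivatives of [f] rather than with the
    acceleration: it can then be differentiated once more along the leaf. *)
Let mcf_q (s : R) := (v1 (curve s) * f1 (G1 (curve s), G2 (curve s)) +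
    v2 (curve s) * f2 (G1 (curve s), G2 (curve s))) / n (curve s).

(** In the moving chart the angle obeys [d alpha/dt = D^2 f (T, T) + Df (H)], with
    [T] the unit tangent and [H] the mean curvature vector. Indeed the time
    derivative of the angle is determined by that of the velocity, which is the
    derivative of [H] along the leaf because second derivatives commute; and [H]
    is [Df (v) / |v|^2] times the rotated velocity. *)
Lemma angle_evolution :
  'D_(@dt R) alpha x0 =
    ('D_(e1 R) f1 y0 * v1 x0 ^+ 2 + 2 * 'D_(e1 R) f2 y0 * v1 x0 * v2 x0
      + 'D_(e2 R) f2 y0 * v2 x0 ^+ 2) / n x0
    + f1 y0 * 'D_(@dt R) G1 x0 + f2 y0 * 'D_(@dt R) G2 x0.
Proof.
have [_ D1] := G1C; have [_ D2] := G2C.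
have v1C : Ck 2 O v1 := D1 _.
have v2C : Ck 2 O v2 := D2 _.
have [_ Df] := fC.
have f1C : Ck 1 O' f1 := Df _.
have f2C : Ck 1 O' f2 := Df _.
have V1 : is_derive s0 1 (fun s => v1 (curve s)) (a1 x0).
  exact: is_derive_curve (Ck_differentiable v1C Ox0).
have V2 : is_derive s0 1 (fun s => v2 (curve s)) (a2 x0).
  exact: is_derive_curve (Ck_differentiable v2C Ox0).
have F1 := is_derive_leaf Ox0 (Ck_differentiable f1C Oy0).
have F2 := is_derive_leaf Ox0 (Ck_differentiable f2C Oy0).
pose L s := (G1 (curve s), G2 (curve s)).
pose d1 := v1 x0 * 'D_(e1 R) f1 y0 + v2 x0 * 'D_(e2 R) f1 y0.
pose d2 := v1 x0 * 'D_(e1 R) f2 y0 + v2 x0 * 'D_(e2 R) f2 y0.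
have Num : is_derive s0 1 (fun s => v1 (curve s) * f1 (L s) + v2 (curve s) * f2 (L s))
    (a1 x0 * f1 y0 + v1 x0 * d1 + (a2 x0 * f2 y0 + v2 x0 * d2)).
  exact: is_deriveD (is_derive_mulr V1 F1) (is_derive_mulr V2 F2).
have Den : is_derive s0 1 (fun s => n (curve s))
    (2 * (v1 x0 * a1 x0 + v2 x0 * a2 x0)).
  apply: (is_derive_eq (is_deriveD (is_derive_mulr V1 V1) (is_derive_mulr V2 V2))).
  by rewrite -/x0; ring.
have nx0 := n0 Ox0.
pose dq := ((a1 x0 * f1 y0 + v1 x0 * d1 + (a2 x0 * f2 y0 + v2 x0 * d2)) * n x0
  - (v1 x0 * f1 y0 + v2 x0 * f2 y0) * (2 * (v1 x0 * a1 x0 + v2 x0 * a2 x0)))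
  / n x0 ^+ 2.
have Q : is_derive s0 1 mcf_q dq.
  exact: (is_derive_divr (g := fun s => n (curve s)) nx0 Num Den).
pose q := (v1 x0 * f1 y0 + v2 x0 * f2 y0) / n x0.
have near_q : \forall s \near s0,
    'D_(@dt R) G1 (curve s) = - (mcf_q s * v2 (curve s)) /\
    'D_(@dt R) G2 (curve s) = mcf_q s * v1 (curve s).
  near=> s.
  have Os : O (curve s) by near: s.
  have -> : mcf_q s =
      (v1 (curve s) * a2 (curve s) - v2 (curve s) * a1 (curve s)) / n (curve s) ^+ 2.
    rewrite (_ : _ - _ = n (curve s) * (v1 (curve s) * f1 (L s) + v2 (curve s) * f2 (L s))).
      have := n0 Os; rewrite /mcf_q; move: (n _) (_ + _) => m w m0; field; exact: m0.
    by near: s.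
  by split; near: s.
have [G1t G2t] := nbhs_singleton near_q.
have dtG1 : Ck 2 O ('D_(@dt R) G1) := D1 _.
have dtG2 : Ck 2 O ('D_(@dt R) G2) := D2 _.
have nearO : \forall x \near x0, O x by exact: open_nbhs_nbhs.
have T1 : 'D_(@dt R) v1 x0 = - (dq * v2 x0 + q * a2 x0).
  rewrite /v1 derive_comm; first last.
  - exact: Ck_differentiable dtG1 Ox0.
  - exact: Ck_differentiable v1C Ox0.
  - by apply: filterS nearO => x Ox; exact: Ck_differentiable G1C Ox.
  have [_ <-] := is_derive_curve (Ck_differentiable dtG1 Ox0).
  have H : is_derive s0 1 (fun s => - (mcf_q s * v2 (curve s))) (- (dq * v2 x0 + q * a2 x0)).
    exact: is_deriveN (is_derive_mulr Q V2).
  have near1 : \forall s \near s0,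
      - (mcf_q s * v2 (curve s)) = 'D_(@dt R) G1 (curve s).
    by apply: filterS near_q => s [].
  by have [_ ->] := near_eq_is_derive near1 H.
have T2 : 'D_(@dt R) v2 x0 = dq * v1 x0 + q * a1 x0.
  rewrite /v2 derive_comm; first last.
  - exact: Ck_differentiable dtG2 Ox0.
  - exact: Ck_differentiable v2C Ox0.
  - by apply: filterS nearO => x Ox; exact: Ck_differentiable G2C Ox.
  have [_ <-] := is_derive_curve (Ck_differentiable dtG2 Ox0).
  have H : is_derive s0 1 (fun s => mcf_q s * v1 (curve s)) (dq * v1 x0 + q * a1 x0).
    exact: is_derive_mulr Q V1.
  have near1 : \forall s \near s0,
      mcf_q s * v1 (curve s) = 'D_(@dt R) G2 (curve s).
    by apply: filterS near_q => s [].
  by have [_ ->] := near_eq_is_derive near1 H.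
have f12 : 'D_(e2 R) f1 y0 = 'D_(e1 R) f2 y0.
  apply: derive_comm.
  - apply: filterS (open_nbhs_nbhs (conj oO' Oy0)) => y Oy.
    exact: Ck_differentiable fC Oy.
  - exact: Ck_differentiable f1C Oy0.
  - exact: Ck_differentiable f2C Oy0.
have curv := nbhs_singleton curvature_near.
have curv' : v1 x0 * a2 x0 - v2 x0 * a1 x0 =
  n x0 * (v1 x0 * f1 y0 + v2 x0 * f2 y0) := curv.
have E0 := alphaE (@dt R) Ox0; rewrite T1 T2 in E0.
have G1t' : 'D_(@dt R) G1 x0 = - (q * v2 x0) := G1t.
have G2t' : 'D_(@dt R) G2 x0 = q * v1 x0 := G2t.
have dqE : dq = ((a1 x0 * f1 y0 +
    v1 x0 * (v1 x0 * 'D_(e1 R) f1 y0 + v2 x0 * 'D_(e1 R) f2 y0) +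
    (a2 x0 * f2 y0 + v2 x0 * (v1 x0 * 'D_(e1 R) f2 y0 + v2 x0 * 'D_(e2 R) f2 y0))) * n x0
  - (v1 x0 * f1 y0 + v2 x0 * f2 y0) * (2 * (v1 x0 * a1 x0 + v2 x0 * a2 x0)))
  / n x0 ^+ 2.
  by rewrite /dq /d1 f12.
have A := evolution_algebra (erefl (n x0)) nx0 curv' (erefl q) dqE.
rewrite -G1t' -G2t' in A.
by rewrite E0.
Unshelve. all: by end_near.
Qed.

End Evolution.

(** * Slices, difference quotients, and uniqueness of lifts *)

Section Slices.
Context {R : realType}.

Lemma derive_slice_l (V X W : normedModType R) (g : V * X -> W) y t h :
  'D_(h, 0) g (y, t) = 'D_h (fun z => g (z, t)) y.
Proof.
suff E : (fun e : R => e^-1 *: ((g \o shift (y, t)) (e *: (h, 0)) - g (y, t))) =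
    (fun e : R => e^-1 *: (((fun z => g (z, t)) \o shift y) (e *: h) - g (y, t))).
  by rewrite /derive E.
apply/funext => e /=; congr (_ *: (g _ - _)).
by apply: injective_projections; rewrite /= ?scaler0 ?add0r.
Qed.

Lemma derive_slice_r (V X W : normedModType R) (g : V * X -> W) y t h :
  'D_(0, h) g (y, t) = 'D_h (fun z => g (y, z)) t.
Proof.
suff E : (fun e : R => e^-1 *: ((g \o shift (y, t)) (e *: (0, h)) - g (y, t))) =
    (fun e : R => e^-1 *: (((fun z => g (y, z)) \o shift t) (e *: h) - g (y, t))).
  by rewrite /derive E.
apply/funext => e /=; congr (_ *: (g _ - _)).
by apply: injective_projections; rewrite /= ?scaler0 ?add0r.
Qed.

Lemma Ck_comp_linear (V X W : normedModType R) k (O : set V) (O' : set X)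
    (L : {linear V -> X}) (g : X -> W) :
  open O -> continuous L -> (forall x, O x -> O' (L x)) -> Ck k O' g ->
  Ck k O (fun x => g (L x)).
Proof.
move=> oO Lc OO'; elim: k g => [|k IH] g gC.
  by move=> x Ox; apply: continuous_comp; [exact: Lc|apply: gC; exact: OO'].
have dL x : differentiable L x by exact: linear_differentiable.
have [dg Dg] := gC; split=> [x Ox|v].
  by apply: (@differentiable_comp _ _ _ _ L g) => //; apply: dg; exact: OO'.
apply: (Ck_eq oO _ (IH _ (Dg (L v)))) => x /set_mem Ox; apply/esym.
have dgx := dg _ (OO' _ Ox).
rewrite deriveE; last exact: (@differentiable_comp _ _ _ _ L g).
by rewrite (@diff_comp _ _ _ _ L g)//= -deriveE// diff_lin.
Qed.

Lemma is_derive_quotient (W : normedModType R) (g : R -> W) (t : R) d :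
  is_derive t 1 g d -> (s - t)^-1 *: (g s - g t) @[s --> t^'] --> d.
Proof.
move=> [/cvg_ex[d' gd] <-].
have -> : 'D_1 g t = d' by exact: cvg_lim gd.
apply/cvgrPdist_lt => e e0; move/cvgrPdist_lt: gd => /(_ e e0) /nbhs_ballP[r /= r0 H].
apply/nbhs_ballP; exists r => // s; rewrite -ball_normE /ball_/= => st snt.
have := H (s - t); rewrite -ball_normE /ball_/= sub0r normrN distrC => /(_ st).
by rewrite subr_eq0 => /(_ snt); rewrite [_%:A]mulr1 subrK.
Qed.

(** The difference of two lifts is continuous with values in the multiples of
    [2 pi], which are isolated, so it is constant near the point. *)
Lemma lift_unique (W : set (R * R * R)) theta p l l' :
  W p -> local_lift W theta p l -> local_lift W theta p l' ->
  exists k : int, \forall q \near p, W q -> l q = l' q + k%:~R * (2 * pi).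
Proof.
move=> Wp [ O [oO Op lc lE]] [ O' [oO' Op' lc' lE']].
have diffE q : (W `&` (O `&` O')) q -> exists k : int, l q - l' q = k%:~R * (2 * pi).
  move=> [Wq [Oq Oq']]; apply/to_angleP.
  by rewrite lE ?lE'// inE; split.
have [k kE] := diffE p (conj Wp (conj Op Op')).
exists k.
have cw (m : R * R * R -> R) (P : set (R * R * R)) : open P -> P p ->
    {within W `&` P, continuous m} -> m @ within W (nbhs p) --> m p.
  move=> oP Pp /subspace_continuousP/(_ p (conj Wp Pp)) mc.
  apply: cvg_trans mc => A /= mA.
  have {}mA : \forall q \near p, (W `&` P) q -> A (m q) := mA.
  have nP : \forall q \near p, P q by exact: open_nbhs_nbhs.
  suff : \forall q \near p, W q -> A (m q) by [].
  by near=> q => Wq; apply: (near mA q) => //; split => //; near: q.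
have dc : (fun q => l q - l' q) @ within W (nbhs p) --> l p - l' p.
  by apply: cvgB; [exact: (cw _ O)|exact: (cw _ O')].
have pi20 : 0 < 2 * pi :> R by rewrite mulr_gt0// pi_gt0.
move/cvgrPdist_lt: dc => /(_ _ pi20).
rewrite near_withinE.
have nO : \forall q \near p, O q by exact: open_nbhs_nbhs.
have nO' : \forall q \near p, O' q by exact: open_nbhs_nbhs.
move: nO nO'; apply: filterS3 => q Oq Oq' H Wq.
have [m mE] := diffE q (conj Wq (conj Oq Oq')).
move: (H Wq); rewrite kE mE -mulrBl normrM (gtr0_norm pi20) -intrB.
rewrite -[X in _ < X]mul1r ltr_pM2r// -intr_norm -[1]/(1%:~R) ltr_int.
move=> km.
have mk : k = m.
  by apply/eqP; rewrite -subr_eq0 -normr_eq0 eq_le normr_ge0 andbT -ltzD1 add0r.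
rewrite mk.
by rewrite -mE addrC subrK.
Unshelve. all: by end_near.
Qed.

End Slices.

Lemma near_open (S : topologicalType) (p : S) (A : set S) :
  (\forall q \near p, A q) ->
  exists B : set S, [/\ open B, B p & forall q, B q -> A q].
Proof.
move=> pA; have {pA} : nbhs p A := pA.
by rewrite nbhsE => -[B [ oB Bp] BA]; exists B.
Qed.

(** * The equation in a chart *)

(** All that is retained of the foliation is a smooth map [(G1, G2)] of position,
    leaf and time, which extends it beyond the initial time, and smooth functions
    [(psi1, psi2)] that invert it at time [t0]. *)
Section LocalEquation.
Context {R : realType}.
Variables (W : set (R * R * R)) (T : \bar R) (theta : R * R * R -> angle R).
Variables (G1 G2 : R * (R * R) -> R) (psi1 psi2 : R * R -> R) (s0 u0 t0 : R).
Variables (O : set (R * (R * R))) (O2 : set (R * R)).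
Let x0 : R * (R * R) := (s0, (u0, t0)).
Let y0 : R * R := (G1 x0, G2 x0).
Let v1 := 'D_(@ds R) G1.
Let v2 := 'D_(@ds R) G2.
Let a1 := 'D_(@ds R) v1.
Let a2 := 'D_(@ds R) v2.
Let n x := v1 x ^+ 2 + v2 x ^+ 2.

Hypothesis WT : forall q, W q -> time_interval T q.2.
Hypothesis Tt0 : time_interval T t0.
Hypothesis oO : open O.
Hypothesis Ox0 : O x0.
Hypothesis G1C : forall k, Ck k O G1.
Hypothesis G2C : forall k, Ck k O G2.
Hypothesis oO2 : open O2.
Hypothesis O2y0 : O2 y0.
Hypothesis psi1C : forall k, Ck k O2 psi1.
Hypothesis psi2C : forall k, Ck k O2 psi2.
Hypothesis psi_y0 : psi1 y0 = s0 /\ psi2 y0 = u0.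
Hypothesis psiK : \forall y \near y0,
  (G1 (psi1 y, (psi2 y, t0)), G2 (psi1 y, (psi2 y, t0))) = y.
Hypothesis GK : \forall s \near s0,
  psi1 (G1 (s, (u0, t0)), G2 (s, (u0, t0))) = s /\
  psi2 (G1 (s, (u0, t0)), G2 (s, (u0, t0))) = u0.
Hypothesis v0 : n x0 != 0.
Let velocity_angle x := W ((G1 x, G2 x), x.2.2) /\
  exists r m : R, [/\ to_angle r = theta ((G1 x, G2 x), x.2.2), 0 <= m,
    v1 x = m * cos r & v2 x = m * sin r].
Hypothesis theta_angle :
  \forall x \near x0, time_interval T x.2.2 -> velocity_angle x.
(* The mean curvature flow in coordinates, as computed in [mean_curvature_leaf]. *)
Hypothesis mcf1 : \forall s \near s0, 'D_(@dt R) G1 (s, (u0, t0)) =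
  - ((v1 (s, (u0, t0)) * a2 (s, (u0, t0)) - v2 (s, (u0, t0)) * a1 (s, (u0, t0)))
     / n (s, (u0, t0)) ^+ 2 * v2 (s, (u0, t0))).
Hypothesis mcf2 : \forall s \near s0, 'D_(@dt R) G2 (s, (u0, t0)) =
  (v1 (s, (u0, t0)) * a2 (s, (u0, t0)) - v2 (s, (u0, t0)) * a1 (s, (u0, t0)))
     / n (s, (u0, t0)) ^+ 2 * v1 (s, (u0, t0)).

Lemma reference_angle : exists r0 m : R,
  [/\ 0 < m, to_angle r0 = theta (y0, t0), v1 x0 = m * cos r0 &
     v2 x0 = m * sin r0].
Proof.
have [_ [r0 [m [E m0 V1 V2]]]] := nbhs_singleton theta_angle Tt0.
exists r0, m; split => //; rewrite lt_def m0 andbT.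
apply: contra v0 => /eqP m00.
by rewrite /n V1 V2 m00 !mul0r expr0n/= addr0.
Qed.

Section WithReference.
Variables r0 m : R.
Hypothesis m0 : 0 < m.
Hypothesis v1E : v1 x0 = m * cos r0.
Hypothesis v2E : v2 x0 = m * sin r0.

(** The component of the velocity in the direction [r0]. *)
Let P x := cos r0 * v1 x + sin r0 * v2 x.

(** The value of the lift at the point is known only modulo [2 pi], so [r0] replaces
    it in the equation; [f] carries the regularity of the lift at time [t0]. *)
Let lift_evolves : Prop :=
  exists l : R * R * R -> R, local_lift W theta (y0, t0) l /\
  exists f : R * R -> R, exists Mf : set (R * R),
  [/\ open Mf, Mf y0, (forall k, Ck k Mf f) &
  [/\ (\forall y \near y0, W (y, t0) /\ l (y, t0) = f y),
   (\forall s \near t0, time_interval T s -> W (y0, s)) &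
   is_derive t0 1 (fun s => l (y0, s))
     ('D_(e1 R) ('D_(e1 R) f) y0 * cos r0 ^+ 2
      + 2 * 'D_(e1 R) ('D_(e2 R) f) y0 * sin r0 * cos r0
      + 'D_(e2 R) ('D_(e2 R) f) y0 * sin r0 ^+ 2)]].

(** The points of the chart where [angle_near r0] gives the angle of the leaf. *)
Let good_point x :=
  [/\ O x, 0 < P x & time_interval T x.2.2 -> velocity_angle x].

Let v1C k : Ck k O v1. Proof. by have [_ D] := G1C k.+1; exact: D. Qed.
Let v2C k : Ck k O v2. Proof. by have [_ D] := G2C k.+1; exact: D. Qed.

Let near_good_point : \forall x \near x0, good_point x.
Proof.
have nO : \forall x \near x0, O x by exact: open_nbhs_nbhs.
have nP : \forall x \near x0, 0 < P x.
  have P0 : 0 < P x0.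
    rewrite /P v1E v2E.
    rewrite (_ : _ + _ = m * (cos r0 ^+ 2 + sin r0 ^+ 2)); last by ring.
    by rewrite cos2Dsin2 mulr1.
  have Pc : P @ x0 --> P x0.
    have : Ck 0%N O P.
      by apply: Ck_add => //; apply: Ck_mul => //; exact: Ck_cst.
    exact.
  exact: cvgr_gt Pc _ P0.
by move: nO nP theta_angle; apply: filterS3 => x; split.
Qed.

Section WithGoodPoints.
Variable O1 : set (R * (R * R)).
Hypothesis oO1 : open O1.
Hypothesis O1x0 : O1 x0.
Hypothesis O1P : forall x, O1 x -> good_point x.

Let O1O : O1 `<=` O. Proof. by move=> x /O1P[]. Qed.

Let P_neq0 x : O1 x -> P x != 0.
Proof. by move=> /O1P[_ P0 _]; rewrite gt_eqF. Qed.

Let n_neq0 x : O1 x -> n x != 0.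
Proof.
move=> /P_neq0; apply: contra => /eqP n00.
have v10 : v1 x = 0.
  apply/eqP; rewrite -sqrf_eq0; apply/eqP; have := sqr_ge0 (v1 x).
  by have := sqr_ge0 (v2 x); move: n00; rewrite /n; lra.
have v20 : v2 x = 0.
  by apply/eqP; rewrite -sqrf_eq0; move: n00; rewrite /n v10 expr0n/= add0r => ->.
by rewrite /P v10 v20 !mulr0 addr0.
Qed.

Let alpha x := angle_near r0 (v1 x) (v2 x).

Let alphaC k : Ck k O1 alpha.
Proof. by apply: Ck_angle_near => //; exact: (Ck_subset O1O). Qed.

Let alphaE x h : O1 x ->
  'D_h alpha x = (v1 x * 'D_h v2 x - v2 x * 'D_h v1 x) / n x.
Proof.
move=> O1x; apply: derive_angle_near; last exact: P_neq0.
- by apply: (@Ck_differentiable R _ _ 0 O) => //; exact: O1O.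
- by apply: (@Ck_differentiable R _ _ 0 O) => //; exact: O1O.
Qed.

(** The chart given by the slice at time [t0], used at all times: in it the
    foliation becomes a family [K] of maps of the plane with [K (-, t0)] the
    identity. *)
Let chart3 (q : R * R * R) : R * (R * R) := (psi1 q.1, (psi2 q.1, q.2)).
Let psiy0 : chart3 (y0, t0) = x0.
Proof. by rewrite /chart3/=; have [-> ->] := psi_y0. Qed.

Let chart3_cvg : chart3 @ (y0, t0) --> x0.
Proof.
have c1 : (fun q : R * R * R => q.1) @ (y0, t0) --> y0.
  exact: (@continuous_fst _ _ (y0, t0)).
have c2 : (fun q : R * R * R => q.2) @ (y0, t0) --> t0.
  exact: (@continuous_snd _ _ (y0, t0)).
rewrite -psiy0.
have pc1 : psi1 @ y0 --> psi1 y0 := psi1C 0%N _ O2y0.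
have pc2 : psi2 @ y0 --> psi2 y0 := psi2C 0%N _ O2y0.
have p1 : (fun q : R * R * R => psi1 q.1) @ (y0, t0) --> psi1 y0.
  exact: (cvg_comp _ _ c1 pc1).
have p2 : (fun q : R * R * R => psi2 q.1) @ (y0, t0) --> psi2 y0.
  exact: (cvg_comp _ _ c1 pc2).
exact: (cvg_pair p1 (cvg_pair p2 c2)).
Qed.

Lemma near_chart_domain : \forall q \near (y0, t0), O2 q.1 /\ O1 (chart3 q).
Proof.
have n1 : \forall q \near (y0, t0), O2 q.1.
  by apply: (@continuous_fst _ _ (y0, t0)); exact: open_nbhs_nbhs.
have nO1 : nbhs x0 O1 by exact: open_nbhs_nbhs.
have n2 : \forall q \near (y0, t0), O1 (chart3 q).
  by apply: chart3_cvg; exact: nO1.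
exact: filterI n1 n2.
Qed.

Section WithDomain.
Variable M : set (R * R * R).
Hypothesis oM : open M.
Hypothesis My0 : M (y0, t0).
Hypothesis MP : forall q, M q -> O2 q.1 /\ O1 (chart3 q).

Let chart3C k (g : R * (R * R) -> R) : Ck k O1 g -> Ck k M (fun q => g (chart3 q)).
Proof.
move=> gC.
apply: (Ck_comp3 (a := fun q => psi1 q.1) (b := fun q => psi2 q.1)
  (c := fun q => q.2) (O' := O1)) => //.
- by apply: (@Ck_comp_linear R _ _ _ k M O2 fst) => //;
    [move=> q; exact: continuous_fst|move=> q /MP[]].
- by apply: (@Ck_comp_linear R _ _ _ k M O2 fst) => //;
    [move=> q; exact: continuous_fst|move=> q /MP[]].
- by apply: (@Ck_linear R _ _ k M snd) => q; exact: continuous_snd.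
- by move=> q /MP[].
Qed.

Let K1 q := G1 (chart3 q).
Let K2 q := G2 (chart3 q).
Let K (q : R * R * R) : R * R := (K1 q, K2 q).
Let beta q := alpha (chart3 q).
Let K1C k : Ck k M K1. Proof. by apply: chart3C; exact: (Ck_subset O1O). Qed.
Let K2C k : Ck k M K2. Proof. by apply: chart3C; exact: (Ck_subset O1O). Qed.
Let betaC k : Ck k M beta. Proof. exact: chart3C. Qed.

Let K0 : K (y0, t0) = y0.
Proof. by rewrite /K /K1 /K2 psiy0. Qed.

Let KC q : M q -> {for q, continuous K}.
Proof. move=> Mq; exact: (cvg_pair (K1C 0%N _ Mq) (K2C 0%N _ Mq)). Qed.

Let K_t0 : \forall y \near y0, K (y, t0) = y.
Proof. exact: psiK. Qed.

(** [K (-, t0)] is the identity near [y0], so the derivative of [K - id] in the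
    plane vanishes at [(y0, t0)]. *)
Let Klip : forall e : R, 0 < e -> exists2 d, 0 < d & forall y1 y2 t,
    ball y0 d y1 -> ball y0 d y2 -> ball t0 d t ->
    `|(K (y1, t) - y1) - (K (y2, t) - y2)| <= e * `|y1 - y2|.
Proof.
move=> e e0.
pose E1 (q : R * R * R) := K1 q - q.1.1.
pose E2 (q : R * R * R) := K2 q - q.1.2.
have q1C : Ck 1 M (fun q : R * R * R => q.1.1).
  apply: (Ck_fst (f := fst)) => //.
  by apply: (@Ck_linear R _ _ 1 M fst) => q; exact: continuous_fst.
have q2C : Ck 1 M (fun q : R * R * R => q.1.2).
  apply: (Ck_snd (f := fst)) => //.
  by apply: (@Ck_linear R _ _ 1 M fst) => q; exact: continuous_fst.
have E1C : Ck 1 M E1 := Ck_subr oM (K1C 1%N) q1C.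
have E2C : Ck 1 M E2 := Ck_subr oM (K2C 1%N) q2C.
have E10 h : 'D_(h, 0) E1 (y0, t0) = 0.
  rewrite derive_slice_l -[RHS](derive_cst (0 : R) y0 h); apply: near_eq_derive.
  move: K_t0; apply: filterS => y Ky.
  have Kyi : K1 (y, t0) = y.1 by rewrite -[in RHS]Ky.
  by rewrite /E1 Kyi subrr.
have E20 h : 'D_(h, 0) E2 (y0, t0) = 0.
  rewrite derive_slice_l -[RHS](derive_cst (0 : R) y0 h); apply: near_eq_derive.
  move: K_t0; apply: filterS => y Ky.
  have Kyi : K2 (y, t0) = y.2 by rewrite -[in RHS]Ky.
  by rewrite /E2 Kyi subrr.
have [d1 d10 H1] := strict_lipschitz_param oM My0 E1C (E10 _) (E10 _) e0.
have [d2 d20 H2] := strict_lipschitz_param oM My0 E2C (E20 _) (E20 _) e0.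
exists (Num.min d1 d2); first by rewrite lt_min d10.
have le1 : Num.min d1 d2 <= d1 by rewrite ge_min lexx.
have le2 : Num.min d1 d2 <= d2 by rewrite ge_min lexx orbT.
move=> y1 y2 t B1 B2 Bt; rewrite prod_normE ge_max /=; apply/andP; split.
  by apply: H1; [exact: le_ball le1 _ B1|exact: le_ball le1 _ B2|exact: le_ball le1 _ Bt].
by apply: H2; [exact: le_ball le2 _ B1|exact: le_ball le2 _ B2|exact: le_ball le2 _ Bt].
Qed.

Let f y := beta (y, t0).
Let Mf := [set y | M (y, t0)].

Let oMf : open Mf.
Proof.
rewrite openE => y My.
have c : (fun z : R * R => (z, t0)) @ y --> (y, t0).
  exact: (cvg_pair cvg_id (cvg_cst t0)).
exact: c _ (open_nbhs_nbhs (conj oM My)).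
Qed.

Let fC k : Ck k Mf f.
Proof.
apply: (Ck_comp3 (a := psi1) (b := psi2) (c := fun=> t0) (O' := O1)) => //.
- by apply: (Ck_subset (O := O2)) => // y /MP[].
- by apply: (Ck_subset (O := O2)) => // y /MP[].
- exact: Ck_cst.
- by move=> y /MP[].
Qed.

Let f_leaf : \forall s \near s0,
  f (G1 (s, (u0, t0)), G2 (s, (u0, t0))) = alpha (s, (u0, t0)).
Proof.
move: GK; apply: filterS => s [E1 E2].
by rewrite /f /beta /chart3 /= E1 E2.
Qed.

Let Hv : R * R := ('D_(@dt R) G1 x0, 'D_(@dt R) G2 x0).

Let evolution : 'D_(@dt R) alpha x0 =
  ('D_(e1 R) ('D_(e1 R) f) y0 * v1 x0 ^+ 2
    + 2 * 'D_(e1 R) ('D_(e2 R) f) y0 * v1 x0 * v2 x0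
    + 'D_(e2 R) ('D_(e2 R) f) y0 * v2 x0 ^+ 2) / n x0
  + 'D_(e1 R) f y0 * Hv.1 + 'D_(e2 R) f y0 * Hv.2.
Proof.
apply: (angle_evolution (O := O1) (O' := Mf)) => //.
- exact: (Ck_subset O1O).
- exact: (Ck_subset O1O).
- by move=> x O1x; apply: Ck_differentiable (alphaC 1%N) O1x.
Qed.

Let is_derive_K : is_derive t0 1 (fun t => K (y0, t)) Hv.
Proof.
have c : is_derive t0 1 (fun t : R => (s0, (u0, t))) (@dt R).
  exact: is_derive_pair (is_derive_cst s0 t0 (1 : R))
    (is_derive_pair (is_derive_cst u0 t0 (1 : R)) (is_derive_id t0 (1 : R))).
have dG (g : R * (R * R) -> R) : Ck 1 O g ->
    is_derive t0 1 (fun t : R => g (s0, (u0, t))) ('D_(@dt R) g x0).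
  move=> gC; apply: (is_derive_comp_curve (c := fun t : R => (s0, (u0, t)))) => //.
  exact: Ck_differentiable gC Ox0.
have -> : (fun t => K (y0, t)) =
    (fun t => (G1 (s0, (u0, t)), G2 (s0, (u0, t)))).
  by apply/funext => t; rewrite /K /K1 /K2 /chart3/=; have [-> ->] := psi_y0.
exact: is_derive_pair (dG _ (G1C 1%N)) (dG _ (G2C 1%N)).
Qed.

(** The lift is [beta (kinv (y, t), t)], where [beta] is the angle in the chart and
    [kinv] undoes the motion of the leaves. At [(y0, t0)] the inverse moves with
    velocity [- H], so the time derivative of the lift is that of [alpha] minus
    [Df (H)]; this cancels the transport term in [angle_evolution]. *)
Lemma lift_evolution : lift_evolves.
Proof.
have [kinv [N [ oN Np KN kC [ kt0 k0 kD]]]] := param_inverse oM My0 K0 KC Klip.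
pose l q := beta (kinv q, q.2).
have kinv_cvg q : N q -> (fun q => (kinv q, q.2)) @ q --> (kinv q, q.2).
  move=> Nq; have c1 : kinv @ q --> kinv q := kC _ Nq.
  have c2 : (fun q : R * R * R => q.2) @ q --> q.2 by exact: continuous_snd.
  exact: (cvg_pair c1 c2).
have [S [ oS Sp SP]] : exists S : set (R * R * R),
    [/\ open S, S (y0, t0) & forall q, S q -> N q /\ M (kinv q, q.2)].
  apply: near_open.
  have n1 : \forall q \near (y0, t0), N q by exact: open_nbhs_nbhs.
  have nM : nbhs (y0, t0) M by exact: open_nbhs_nbhs.
  have n2 : \forall q \near (y0, t0), M (kinv q, q.2).
    have := kinv_cvg _ Np; rewrite k0 /= => c.
    exact: c _ nM.
  exact: filterI n1 n2.
have SW q : S q -> time_interval T q.2 -> W q /\ to_angle (l q) = theta q.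
  move=> /SP[Nq Mq] Tq; have [ O2k O1k] := MP Mq.
  have [_ P0 /(_ Tq)] := O1P O1k.
  have := KN _ Nq; rewrite /velocity_angle /K /K1 /K2 => -> /=.
  rewrite -surjective_pairing => -[Wq [r [k [rE k0' V1 V2]]]]; split => //.
  by rewrite -rE; exact: (angle_nearP k0' V1 V2 P0).
have nS : nbhs (y0, t0) S by exact: open_nbhs_nbhs.
have Sy : \forall y \near y0, S (y, t0).
  have c : (fun y : R * R => (y, t0)) @ y0 --> (y0, t0).
    exact: (cvg_pair cvg_id (cvg_cst t0)).
  exact: c _ nS.
have St : \forall s \near t0, S (y0, s).
  have c : (fun s : R => (y0, s)) @ t0 --> (y0, t0).
    exact: (cvg_pair (cvg_cst y0) cvg_id).
  exact: c _ nS.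
exists l; split.
  exists S; split => //.
    apply: continuous_in_subspaceT => q /set_mem[_ /SP[Nq Mq]].
    have c := kinv_cvg _ Nq.
    have bc : beta @ (kinv q, q.2) --> beta (kinv q, q.2) := betaC 0%N _ Mq.
    exact: (cvg_comp _ _ c bc).
  by move=> q; rewrite inE => -[Wq /SW/(_ (WT Wq))[]].
exists f, Mf; split => //; split.
- move: Sy kt0 K_t0; apply: filterS3 => y Syt [_ kE] Ky; split.
    by have [] := SW _ Syt Tt0.
  by rewrite /l /= kE.
- by move: St; apply: filterS => s Ss Ts; have [] := SW _ Ss Ts.
have c : is_derive t0 1 (fun s => (kinv (y0, s), s)) (- Hv, 1).
  exact: is_derive_pair (kD _ is_derive_K) (is_derive_id t0 (1 : R)).
have dbeta : differentiable beta (kinv (y0, t0), t0).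
  by rewrite k0; exact: Ck_differentiable (betaC 1%N) My0.
apply: (is_derive_eq (is_derive_comp_curve c dbeta)); rewrite k0.
have -> : (- Hv, 1) = (- Hv, 0) + (0, 1) :> R * R * R.
  by apply: injective_projections; rewrite /= ?addr0 ?add0r.
rewrite k0 in dbeta; rewrite derive_dirD// derive_slice_l derive_slice_r.
have -> : (fun z => beta (y0, z)) = (fun z => alpha (s0, (u0, z))).
  by apply/funext => z; rewrite /beta /chart3/=; have [-> ->] := psi_y0.
have -> : 'D_1 (fun z => alpha (s0, (u0, z))) t0 = 'D_(@dt R) alpha x0.
  by rewrite /dt !derive_slice_r.
rewrite evolution.
have -> : 'D_(- Hv) (fun z => beta (z, t0)) y0 =
    - ('D_(e1 R) f y0 * Hv.1 + 'D_(e2 R) f y0 * Hv.2).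
  have df : differentiable f y0 by exact: Ck_differentiable (fC 1%N) My0.
  rewrite (_ : - Hv = (- Hv.1, - Hv.2))// [LHS]derive_coord2//.
  by rewrite /GRing.scale/= opprD !mulNr [Hv.1 * _]mulrC [Hv.2 * _]mulrC.
have mm : (m * cos r0) ^+ 2 + (m * sin r0) ^+ 2 = m ^+ 2.
  by rewrite !exprMn -mulrDr cos2Dsin2 mulr1.
have algebra (f11 f12 f22 p1 p2 h1 h2 : R) :
    - (p1 * h1 + p2 * h2) +
    ((f11 * (m * cos r0) ^+ 2 + 2 * f12 * (m * cos r0) * (m * sin r0)
      + f22 * (m * sin r0) ^+ 2) / m ^+ 2 + p1 * h1 + p2 * h2) =
    f11 * cos r0 ^+ 2 + 2 * f12 * sin r0 * cos r0 + f22 * sin r0 ^+ 2.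
  by field; rewrite gt_eqF.
by rewrite /n v1E v2E mm algebra.
Qed.

End WithDomain.

End WithGoodPoints.

Lemma lift_evolution_at_reference : lift_evolves.
Proof.
have [ O1 [ oO1 O1x0 O1P]] := near_open near_good_point.
have [M [ oM My0 MP]] := near_open (near_chart_domain oO1 O1x0).
exact: (lift_evolution oO1 O1x0 O1P oM My0 MP).
Qed.

End WithReference.

(** An arbitrary lift differs from the one of [lift_evolution] by a constant
    multiple of [2 pi] near the point, and neither the derivatives nor the
    trigonometric coefficients see this constant. *)
Lemma angle_equation_local :
  (exists l : R * R * R -> R, local_lift W theta (y0, t0) l) /\
  (forall l : R * R * R -> R, local_lift W theta (y0, t0) l ->
     angle_equation_at T l (y0, t0)).
Proof.
have [r0 [m [m0 r0E v1E v2E]]] := reference_angle.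
have [l0 [lift0 [f [Mf [ oMf Mfy0 fC [Wf Wt dl0]]]]]] :=
  lift_evolution_at_reference m0 v1E v2E.
split; first by exists l0.
move=> l liftl.
have [Wp l0f] := nbhs_singleton Wf.
have [k lE] := lift_unique Wp liftl lift0.
have lp : to_angle (l (y0, t0)) = to_angle r0.
  have [B [_ Bp _ /(_ (y0, t0))->]] := liftl => //.
  by rewrite inE; split.
have [cE sE] := (to_angle_trig _ _).1 lp.
pose g y := f y + k%:~R * (2 * pi).
have gC j : Ck j Mf g by apply: Ck_add => //; exact: Ck_cst.
have lg : \forall y \near y0, l (y, t0) = g y.
  have c : (fun y : R * R => (y, t0)) @ y0 --> (y0, t0).
    exact: (cvg_pair cvg_id (cvg_cst t0)).
  have lEy : \forall y \near y0,
      W (y, t0) -> l (y, t0) = l0 (y, t0) + k%:~R * (2 * pi) := c _ lE.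
  move: lEy Wf; apply: filterS2 => y E [Wy fE].
  by rewrite (E Wy) fE.
have lg2 := near_join lg.
have Dlg v : \forall y \near y0, 'D_v (fun z => l (z, t0)) y = 'D_v g y.
  by move: lg2; apply: filterS => y; exact: near_eq_derive.
have Dgf v : \forall y \near y0, 'D_v g y = 'D_v f y.
  have nM : \forall y \near y0, Mf y by exact: open_nbhs_nbhs.
  move: nM; apply: filterS => y My.
  rewrite deriveD; [|apply: diff_derivable; exact: Ck_differentiable (fC 1%N) My|].
    by rewrite derive_cst addr0.
  exact: derivable_cst.
have DDE v w : 'D_v ('D_w (fun z => l (z, t0))) y0 = 'D_v ('D_w f) y0.
  rewrite (near_eq_derive _ (Dlg w)); exact: near_eq_derive.
split.
  move=> v w _ _; split => /=.
    have nM : \forall y \near y0, Mf y by exact: open_nbhs_nbhs.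
    move: nM lg2; apply: filterS2 => y My lgy.
    apply: (near_eq_derivable (f := g)).
      by move: lgy; apply: filterS => z ->.
    by apply: diff_derivable; exact: Ck_differentiable (gC 1%N) My.
  apply: (near_eq_derivable (f := 'D_v g)).
    by move: (Dlg v); apply: filterS => z ->.
  have Dg : Ck 1 Mf ('D_v g) := (gC 2%N).2 v.
  by apply: diff_derivable; exact: Ck_differentiable Dg Mfy0.
rewrite /is_derive_within /= cE sE (DDE (e1 R) (e1 R)) (DDE (e1 R) (e2 R)) (DDE (e2 R) (e2 R)).
have q0 := is_derive_quotient dl0.
have q1 : (fun s => (s - t0)^-1 *: (l0 (y0, s) - l0 (y0, t0)))
    @ within (time_interval T) t0^' --> _ := cvg_trans (cvg_app _ (@cvg_within _ _ _ _)) q0.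
apply: (cvg_trans _ (q1 _)); apply: near_eq_cvg.
have c : (fun s : R => (y0, s)) @ t0 --> (y0, t0).
  exact: (cvg_pair (cvg_cst y0) cvg_id).
have lEs : \forall s \near t0,
    W (y0, s) -> l (y0, s) = l0 (y0, s) + k%:~R * (2 * pi) := c _ lE.
have lEt : \forall s \near t0, time_interval T s ->
    l (y0, s) - l (y0, t0) = l0 (y0, s) - l0 (y0, t0).
  move: lEs Wt; apply: filterS2 => s ls Ws Ts.
  rewrite (ls (Ws Ts)) (nbhs_singleton lE Wp); ring.
by rewrite near_withinE; apply: nbhs_dnbhs; apply: filterS lEt => s H Is; rewrite H.
Qed.
End LocalEquation.

(** * Leaves and their mean curvature *)

Section Geometry.
Context {R : realType}.

Lemma derive1_leaf (W : normedModType R) (gamma : R -> W)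
    (g : R * (R * R) -> W) s q :
  (\forall z \near s, gamma z = g (z, q)) ->
  derive1 gamma s = 'D_(@ds R) g (s, q).
Proof.
by move=> E; rewrite derive1E (near_eq_derive _ E) -derive_slice_l.
Qed.

(** In the plane the normal part of the acceleration is its component along the
    velocity rotated by a right angle. *)
Lemma mean_curvature_leaf (gamma : R -> R * R) (g : R * (R * R) -> R * R) s q
    (v := 'D_(@ds R) g (s, q)) (a := 'D_(@ds R) ('D_(@ds R) g) (s, q))
    (w := (v.1 * a.2 - v.2 * a.1) / (v.1 ^+ 2 + v.2 ^+ 2) ^+ 2) :
  (\forall z \near s, gamma z = g (z, q)) -> derive1 gamma s != 0 ->
  mean_curvature gamma s = (- (w * v.2), w * v.1).
Proof.
move=> E; have E2 : \forall z \near s, derive1 gamma z = 'D_(@ds R) g (z, q).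
  by move: (near_join E); apply: filterS => z; exact: derive1_leaf.
rewrite /mean_curvature /second_fundamental_form.
have DE : derive1 gamma s = v by exact: derive1_leaf.
have DE2 : derive1 (derive1 gamma) s = a.
  exact: (derive1_leaf (gamma := derive1 gamma) (g := 'D_(@ds R) g)).
rewrite DE DE2 => {E E2 DE DE2}.
rewrite /w; clearbody v a; case: v a {w} => [v1 v2] [a1 a2] /= vn0.
rewrite /dot /= -!expr2.
have n0 : v1 ^+ 2 + v2 ^+ 2 != 0.
  apply: contra vn0; rewrite paddr_eq0 ?sqr_ge0// !sqrf_eq0.
  by move=> /andP[/eqP-> /eqP->].
by apply: injective_projections; rewrite /= /GRing.scale/=; field.
Qed.

Lemma time_interval_within_proper (T : \bar R) t :
  time_interval T t -> ProperFilter (within (time_interval T) t^').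
Proof.
move=> [t0 tT]; apply: Build_ProperFilter_ex => A.
rewrite /within /= => /nbhs_ballP[e /= e0 He].
have [d d0 dT] : exists2 d, 0 < d & ((t + d)%:E < T)%E.
  clear He; move: tT; case: T => [r| |] //; rewrite ?lte_fin => tr.
    by exists ((r - t) / 2); rewrite ?lte_fin; lra.
  by exists 1; rewrite ?ltry.
pose h := Num.min d (e / 2).
have h0 : 0 < h by rewrite lt_min d0/=; lra.
have hd : h <= d by rewrite ge_min lexx.
have he : h < e by rewrite gt_min; apply/orP; right; lra.
exists (t + h); apply: He => /=.
- by rewrite -ball_normE /ball_/= opprD addrA subrr add0r normrN gtr0_norm.
- by rewrite gt_eqF// ltrDl.
- split; first by rewrite addr_ge0// ltW.
  by apply: le_lt_trans dT; rewrite lee_fin lerD2l.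
Qed.

(** At the initial time the flow only has a one-sided derivative. It coincides
    with the two-sided derivative of any differentiable extension, because times
    in the interval accumulate at [t]. *)
Lemma is_derive_within_unique (W : normedModType R) (T : \bar R) (f g : R -> W)
    t d d' : time_interval T t ->
  is_derive_within (time_interval T) f t d -> is_derive t 1 g d' ->
  (\forall s \near t, time_interval T s -> f s = g s) -> d' = d.
Proof.
move=> Tt fd gd fg.
have PF := time_interval_within_proper Tt.
have q1 := cvg_trans (cvg_app _ (@cvg_within _ _ _ (time_interval T))) (is_derive_quotient gd).
apply: (norm_cvg_unique (q1 _)).
apply: (cvg_trans _ fd); apply: near_eq_cvg.
have ft : f t = g t by exact: nbhs_singleton fg Tt.
rewrite near_withinE; apply: nbhs_dnbhs; apply: filterS fg => s H Is.
by rewrite H// ft.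
Qed.

End Geometry.

(** * The Lagrangian angle of a foliation moved under mean curvature flow *)

Lemma smooth_on_open (R : realType) (V W : normedModType R) (S : set V)
    (f : V -> W) p : S p -> smooth_on S f ->
  exists O g, [/\ open O, O p, (forall k, Ck k O g) &
    forall q, S q -> O q -> f q = g q].
Proof.
move=> Sp /(_ p Sp)[ O [g [ oO Op gC fg]]]; exists O, g; split => // q Sq Oq.
by apply: fg; rewrite inE; split.
Qed.

Theorem theorem3p1 (R : realType) (L : topologicalType) (A : set (chart R L))
  (hL : oriented_1manifold A)
  (U : set R) (hU : open U) (T : \bar R)
  (F : L -> R -> R -> plane R) (hF : mcf_foliation A U T F)
  (theta : plane R * R -> angle R) (htheta : foliation_angle A U T F theta)
  (p : plane R * R) (hp : spacetime U T F p) :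
  (exists l : plane R * R -> R, local_lift (spacetime U T F) theta p l) /\
  (forall l : plane R * R -> R, local_lift (spacetime U T F) theta p l ->
     angle_equation_at T l p).
Proof.
case: p hp => y0 t0 [/= Tt0 [x0 [u0 Uu0 Fx0]]].
have [c Ac cx0] := atlas_cover (manifold_atlas hL) x0.
have cc := atlas_chart (manifold_atlas hL) Ac.
have codo := chart_cod_open cc.
have mapK x : chart_dom c x -> chart_inv c (chart_map c x) = x.
  by move=> cx; apply: (chart_mapK cc); rewrite inE.
have map_cod x : chart_dom c x -> chart_cod c (chart_map c x).
  by move=> cx; exists x.
have inv_dom s : chart_cod c s ->
    chart_dom c (chart_inv c s) /\ chart_map c (chart_inv c s) = s.
  by move=> [x cx <-]; rewrite mapK.
pose s0 := chart_map c x0.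
have Us : (chart_cod c `*` (U `*` time_interval T)) (s0, (u0, t0)).
  by split; [exact: map_cod|split].
(* [g] extends the flow in the chart to a neighbourhood of [(s0, (u0, t0))], hence
   to times slightly before [0] when [t0 = 0]. *)
have [ O [g [ oO Ox0 gC Fg]]] := smooth_on_open Us (foliation_smooth hF Ac).
have {}Fg s u t : chart_cod c s -> U u -> time_interval T t -> O (s, (u, t)) ->
    F (chart_inv c s) u t = g (s, (u, t)).
  by move=> cs Uu Tt Ost; apply: (Fg (s, (u, t))) => //; split.
pose G1 x := (g x).1; pose G2 x := (g x).2.
have G1C k : Ck k O G1 by apply: Ck_fst.
have G2C k : Ck k O G2 by apply: Ck_snd.
have gE x : (G1 x, G2 x) = g x by rewrite /G1 /G2 -surjective_pairing.
have y0E : y0 = g (s0, (u0, t0)).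
  by rewrite -Fx0 -Fg ?mapK//; exact: map_cod.
have Dg h x : O x -> 'D_h g x = ('D_h G1 x, 'D_h G2 x).
  move=> Ox; have dg := Ck_differentiable (gC 1%N) Ox.
  have [_ /= ->] := is_derive_fst (differentiable_is_derive h dg).
  have [_ /= ->] := is_derive_snd (differentiable_is_derive h dg).
  by rewrite -surjective_pairing.
have near_s s u t : chart_cod c s -> U u -> time_interval T t -> O (s, (u, t)) ->
    \forall z \near s, leaf F c u t z = g (z, (u, t)).
  move=> cs Uu Tt Ost.
  have e : (fun z : R => (z, (u, t))) @ s --> (s, (u, t)).
    exact: (cvg_pair cvg_id (cvg_cst (u, t))).
  have n1 : \forall z \near s, O (z, (u, t)) := e _ (open_nbhs_nbhs (conj oO Ost)).
  have n2 : \forall z \near s, chart_cod c z by exact: open_nbhs_nbhs.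
  by move: n1 n2; apply: filterS2 => z Oz cz; exact: Fg.
have leaf_v s u t : chart_cod c s -> U u -> time_interval T t -> O (s, (u, t)) ->
    derive1 (leaf F c u t) s =
    ('D_(@ds R) G1 (s, (u, t)), 'D_(@ds R) G2 (s, (u, t))).
  move=> cs Uu Tt Ost; rewrite -Dg//; apply: derive1_leaf; exact: near_s.
have leaf_v0 s u t : chart_cod c s -> U u -> time_interval T t ->
    derive1 (leaf F c u t) s != 0.
  by move=> cs Uu Tt; exact: (embedding_immersion (foliation_embedding hF Uu Tt)).
(* The inverse of the slice at time [t0], read in the chart, provides [psi1] and
   [psi2]. *)
have sd := foliation_diffeomorphism hF Tt0.
have oS := slice_open sd.
have [gL [gU [gK [gLc gLs] gUs]]] := slice_inverse sd.
have Sy0 : slice U F t0 y0 by exists x0, u0.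
have [gL0 gU0] : gL y0 = x0 /\ gU y0 = u0 by rewrite -Fx0; exact: gK.
have Sdom : (slice U F t0 `&` gL @^-1` chart_dom c) y0 by split => //=; rewrite gL0.
have [ O1 [psi1 [ oO1 O1y0 psi1C psi1E]]] := smooth_on_open Sdom (gLs c Ac).
have [ O2 [psi2 [ oO2 O2y0 psi2C psi2E]]] := smooth_on_open Sy0 gUs.
have near_S : \forall y \near y0, slice U F t0 y by exact: open_nbhs_nbhs.
have near_dom : \forall y \near y0, chart_dom c (gL y).
  have gL_cvg : gL @ within (slice U F t0) (nbhs y0) --> gL y0.
    by have /subspace_continuousP := gLc; exact.
  have nd : nbhs (gL y0) (chart_dom c).
    by rewrite gL0; apply: open_nbhs_nbhs; split => //; exact: chart_dom_open.
  have H : \forall y \near y0, slice U F t0 y -> chart_dom c (gL y) := gL_cvg _ nd.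
  by move: H near_S; apply: filterS2 => y; exact.
have near_psi1 : \forall y \near y0, psi1 y = chart_map c (gL y).
  have n1 : \forall y \near y0, O1 y by exact: open_nbhs_nbhs.
  move: n1 near_S near_dom; apply: filterS3 => y Oy Sy dy.
  by rewrite -psi1E//; split.
have near_psi2 : \forall y \near y0, psi2 y = gU y.
  have n1 : \forall y \near y0, O2 y by exact: open_nbhs_nbhs.
  by move: n1 near_S; apply: filterS2 => y Oy Sy; rewrite -psi2E.
have psi1_0 : psi1 y0 = s0 by rewrite (nbhs_singleton near_psi1) gL0.
have psi2_0 : psi2 y0 = u0 by rewrite (nbhs_singleton near_psi2) gU0.
have psi_cvg : (fun y => (psi1 y, (psi2 y, t0))) @ y0 --> (s0, (u0, t0)).
  have c1 : psi1 @ y0 --> psi1 y0 := psi1C 0%N _ O1y0.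
  have c2 : psi2 @ y0 --> psi2 y0 := psi2C 0%N _ O2y0.
  rewrite -psi1_0 -psi2_0.
  exact: (cvg_pair c1 (cvg_pair c2 (cvg_cst t0))).
have near_psiK : \forall y \near y0, g (psi1 y, (psi2 y, t0)) = y.
  have n1 : \forall y \near y0, O (psi1 y, (psi2 y, t0)).
    exact: psi_cvg _ (open_nbhs_nbhs (conj oO Ox0)).
  have n2 : \forall y \near y0, slice U F t0 y /\ chart_dom c (gL y).
    exact: filterI near_S near_dom.
  have n3 : \forall y \near y0, psi1 y = chart_map c (gL y) /\ psi2 y = gU y.
    exact: filterI near_psi1 near_psi2.
  move: n1 n2 n3; apply: filterS3 => y Oy [[x [u Uu Fxu]] dy] [E1 E2].
  have [gLx gUu] := gK x u Uu; rewrite Fxu in gLx gUu.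
  have E1' : psi1 y = chart_map c x by rewrite E1 gLx.
  have E2' : psi2 y = u by rewrite E2.
  rewrite gLx in dy; rewrite E1' E2' in Oy *.
  by rewrite -Fg// ?mapK//; exact: map_cod.
have near_cod : \forall s \near s0, chart_cod c s /\ O (s, (u0, t0)).
  have e : (fun z : R => (z, (u0, t0))) @ s0 --> (s0, (u0, t0)).
    exact: (cvg_pair cvg_id (cvg_cst (u0, t0))).
  have n1 : \forall z \near s0, O (z, (u0, t0)) := e _ (open_nbhs_nbhs (conj oO Ox0)).
  have n2 : \forall z \near s0, chart_cod c z.
    by apply: open_nbhs_nbhs; split => //; exact: map_cod.
  exact: filterI n2 n1.
have near_gK : \forall s \near s0,
    psi1 (g (s, (u0, t0))) = s /\ psi2 (g (s, (u0, t0))) = u0.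
  have gc : (fun s : R => g (s, (u0, t0))) @ s0 --> y0.
    have e : (fun z : R => (z, (u0, t0))) @ s0 --> (s0, (u0, t0)).
      exact: (cvg_pair cvg_id (cvg_cst (u0, t0))).
    have gx : g @ (s0, (u0, t0)) --> g (s0, (u0, t0)) := gC 0%N _ Ox0.
    by rewrite y0E; exact: (cvg_comp _ _ e gx).
  have n1 : \forall s \near s0, psi1 (g (s, (u0, t0))) = chart_map c (gL (g (s, (u0, t0)))).
    exact: gc _ near_psi1.
  have n2 : \forall s \near s0, psi2 (g (s, (u0, t0))) = gU (g (s, (u0, t0))).
    exact: gc _ near_psi2.
  move: near_cod n1 n2; apply: filterS3 => s [cs Os] -> ->.
  have [_ ms] := inv_dom s cs.
  have [gLx gUu] := gK (chart_inv c s) u0 Uu0.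
  by rewrite Fg// in gLx gUu; rewrite gLx gUu ms.
pose v1 := 'D_(@ds R) G1; pose v2 := 'D_(@ds R) G2.
pose a1 := 'D_(@ds R) v1; pose a2 := 'D_(@ds R) v2.
pose n x := v1 x ^+ 2 + v2 x ^+ 2.
have Dg2 x : O x -> 'D_(@ds R) ('D_(@ds R) g) x = (a1 x, a2 x).
  move=> Ox; have dg : Ck 1 O ('D_(@ds R) g) := (gC 2%N).2 _.
  have nO : \forall y \near x, O y by exact: open_nbhs_nbhs.
  have [_ E1] := is_derive_fst (differentiable_is_derive (@ds R) (Ck_differentiable dg Ox)).
  have [_ E2] := is_derive_snd (differentiable_is_derive (@ds R) (Ck_differentiable dg Ox)).
  rewrite [LHS]surjective_pairing -E1 -E2 /a1 /a2; congr (_, _); apply: near_eq_derive;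
    by apply: filterS nO => y Oy; rewrite Dg.
(* The flow equation is needed on the leaf near [s0], because it is going to be
   differentiated along the leaf. *)
have near_mcf : \forall s \near s0, 'D_(@dt R) g (s, (u0, t0)) =
    (- ((v1 (s, (u0, t0)) * a2 (s, (u0, t0)) - v2 (s, (u0, t0)) * a1 (s, (u0, t0)))
       / n (s, (u0, t0)) ^+ 2 * v2 (s, (u0, t0))),
     (v1 (s, (u0, t0)) * a2 (s, (u0, t0)) - v2 (s, (u0, t0)) * a1 (s, (u0, t0)))
       / n (s, (u0, t0)) ^+ 2 * v1 (s, (u0, t0))).
  apply: filterS near_cod => s [cs Os].
  have [ds ms] := inv_dom s cs.
  have Fd := foliation_mcf hF Ac ds Uu0 Tt0.
  have c3 : is_derive t0 1 (fun t : R => (s, (u0, t))) (@dt R).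
    exact: is_derive_pair (is_derive_cst s t0 (1 : R))
      (is_derive_pair (is_derive_cst u0 t0 (1 : R)) (is_derive_id t0 (1 : R))).
  have gd := is_derive_comp_curve c3 (Ck_differentiable (gC 1%N) Os).
  have Fgt : \forall t \near t0, time_interval T t ->
      F (chart_inv c s) u0 t = g (s, (u0, t)).
    have e : (fun t : R => (s, (u0, t))) @ t0 --> (s, (u0, t0)).
      exact: (cvg_pair (cvg_cst s) (cvg_pair (cvg_cst u0) cvg_id)).
    have n1 : \forall t \near t0, O (s, (u0, t)) := e _ (open_nbhs_nbhs (conj oO Os)).
    by apply: filterS n1 => t Ot Tt; exact: Fg.
  have -> := is_derive_within_unique Tt0 Fd gd Fgt.
  rewrite ms (mean_curvature_leaf (near_s _ _ _ cs Uu0 Tt0 Os)); last exact: leaf_v0.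
  by rewrite Dg// Dg2.
have cs0 : chart_cod c s0 by exact: map_cod.
have v0 : n (s0, (u0, t0)) != 0.
  have := leaf_v0 s0 u0 t0 cs0 Uu0 Tt0; rewrite leaf_v//; apply: contra.
  rewrite paddr_eq0 ?sqr_ge0// !sqrf_eq0 => /andP[/eqP E1 /eqP E2].
  by apply/eqP; exact: (f_equal2 pair E1 E2).
have [thetaF leafF thetaE] := htheta.
have near_theta : \forall x \near (s0, (u0, t0)), time_interval T x.2.2 ->
    spacetime U T F ((G1 x, G2 x), x.2.2) /\
    exists r m : R, [/\ to_angle r = theta ((G1 x, G2 x), x.2.2), 0 <= m,
      v1 x = m * cos r & v2 x = m * sin r].
  have n1 : \forall x \near (s0, (u0, t0)), O x by exact: open_nbhs_nbhs.
  have n2 : \forall x \near (s0, (u0, t0)), chart_cod c x.1.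
    have c1 := @continuous_fst _ _ (s0, (u0, t0)).
    exact: c1 _ (open_nbhs_nbhs (conj codo cs0)).
  have n3 : \forall x \near (s0, (u0, t0)), U x.2.1.
    have c1 := cvg_comp _ _ (@continuous_snd _ _ (s0, (u0, t0))) (@continuous_fst _ _ (u0, t0)).
    exact: c1 _ (open_nbhs_nbhs (conj hU Uu0)).
  move: n1 n2 n3; apply: filterS3 => -[s [u t]] /= Ox cs Uu Tt.
  have [ds ms] := inv_dom s cs.
  have Fx : F (chart_inv c s) u t = g (s, (u, t)) by exact: Fg.
  rewrite gE -Fx; split; first by split => //=; exists (chart_inv c s), u.
  have [r rE vE] := leafF c (chart_inv c s) u t Ac ds Uu Tt.
  exists r, (enorm (derive1 (leaf F c u t) (chart_map c (chart_inv c s)))).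
  rewrite thetaE// rE; split => //; first exact: sqrtr_ge0.
    by move: vE; rewrite {1}ms leaf_v// => -[].
  by move: vE; rewrite {1}ms leaf_v// => -[].
have pE : (y0, t0) = ((G1 (s0, (u0, t0)), G2 (s0, (u0, t0))), t0).
  by rewrite gE -y0E.
rewrite pE.
have y0E' : y0 = (G1 (s0, (u0, t0)), G2 (s0, (u0, t0))) by rewrite gE.
apply: (angle_equation_local (psi1 := psi1) (psi2 := psi2) (O := O) (O2 := O1 `&` O2)) => //.
- by move=> q [].
- exact: openI.
- by rewrite -y0E'.
- by move=> k; apply: (Ck_subset (O := O1)) => // y [].
- by move=> k; apply: (Ck_subset (O := O2)) => // y [].
- by rewrite -y0E'.
- by rewrite -y0E'; apply: filterS near_psiK => y; rewrite gE.
- by apply: filterS near_gK => s; rewrite gE.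
- move: near_cod near_mcf; apply: filterS2 => s [_ Os].
  by rewrite Dg// => -[].
- move: near_cod near_mcf; apply: filterS2 => s [_ Os].
  by rewrite Dg// => -[].
Qed.
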